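(* (1) Let $S$ be a trace class operator on $L^2(\mathbb{R}^d)$ such that the set $\{z\in\mathbb{R}^{2d}:\mathcal{F}_W(S)(z)=0\}$ has dense complement in $\mathbb{R}^{2d}$. Then any measurable $\Omega\subset\mathbb{R}^{2d}$ with finite Lebesgue measure is uniquely determined by the operator $\chi_\Omega\star S$, up to Lebesgue measure zero; that is, if $\Omega,\Omega'$ have finite Lebesgue measure and $\chi_\Omega\star S=\chi_{\Omega'}\star S$, then $\mu(\Omega\triangle\Omega')=0$. (2) Let $\varphi_1,\varphi_2\in L^2(\mathbb{R}^d)$ be such that the set $\{z\in\mathbb{R}^{2d}:A(\varphi_2,\varphi_1)(z)=0\}$ has dense complement in $\mathbb{R}^{2d}$. Then any measurable $\Omega\subset\mathbb{R}^{2d}$ with finite Lebesgue measure is uniquely determined, up to Lebesgue measure zero, by the operator $\mathcal{A}_\Omega^{\varphi_1,\varphi_2}$.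
   Context: $\mu$ is Lebesgue measure, $\triangle$ symmetric difference, $\langle\cdot,\cdot\rangle$ the $L^2(\mathbb{R}^d)$ inner product (antilinear in the second argument). For $z=(x,\omega)\in\mathbb{R}^{2d}$, $\pi(z)\psi(t)=e^{2\pi i\omega\cdot t}\psi(t-x)$, $\alpha_z(A)=\pi(z)A\pi(z)^*$, $V_\varphi\psi(z)=\langle\psi,\pi(z)\varphi\rangle$, and the cross-ambiguity function is $A(\psi,\varphi)(z)=e^{\pi i x\cdot\omega}V_\varphi\psi(z)$. The Fourier-Wigner transform is $\mathcal{F}_W S(z)=e^{-\pi i x\cdot\omega}\,\mathrm{tr}(\pi(-z)S)$. For $f\in L^1(\mathbb{R}^{2d})$ and $S$ trace class, $f\star S=\iint f(z)\alpha_z(S)\,dz$ (weak integral: $\langle(f\star S)\psi,\phi\rangle=\iint f(z)\langle\alpha_z(S)\psi,\phi\rangle\,dz$). $\mathcal{A}_\Omega^{\varphi_1,\varphi_2}\psi=\iint_\Omega V_{\varphi_1}\psi(z)\,\pi(z)\varphi_2\,dz$ (weak integral) is the localization operator with mask $\chi_\Omega$ and windows $\varphi_1,\varphi_2$. ''Determined up to Lebesgue measure zero'' means that two sets giving the same operator have symmetric difference of measure zero. *)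

(* Defs.v *)
From HB Require Import structures.
From mathcomp Require Import all_boot all_order all_algebra.
From mathcomp Require Import all_classical all_reals all_analysis.
From mathcomp Require Import complex.

Set Implicit Arguments.
Unset Strict Implicit.
Unset Printing Implicit Defensive.
Import Order.TTheory GRing.Theory Num.Theory.
Import numFieldNormedType.Exports.

Local Open Scope classical_set_scope.
Local Open Scope ring_scope.
Local Open Scope complex_scope.

(* The sigma-algebra of 'rV[R]_n is generated by the coordinate maps, that is,
   it is the Borel sigma-algebra of R^n. *)

Definition rV_display : measure_display. Proof. exact: default_measure_display. Qed.

Section measurable_rV.
Context {R : realType}.
Variable n : nat.

Let coord (i : 'I_n) (x : 'rV[R]_n) : R := x ord0 i.

Let rV_set0 : g_sigma_preimage coord set0.
Proof. exact: sigma_algebra0. Qed.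

Let rV_setC A : g_sigma_preimage coord A -> g_sigma_preimage coord (~` A).
Proof. exact: sigma_algebraC. Qed.

Let rV_bigcup (F : _^nat) : (forall i, g_sigma_preimage coord (F i)) ->
  g_sigma_preimage coord (\bigcup_i (F i)).
Proof. exact: sigma_algebra_bigcup. Qed.

HB.instance Definition _ := @isMeasurable.Build rV_display
  'rV[R]_n (g_sigma_preimage coord) rV_set0 rV_setC rV_bigcup.

End measurable_rV.

Section measurable_fun_rV.
Context {R : realType} d (T : measurableType d).

Lemma measurable_coord n (i : 'I_n) :
  measurable_fun [set: 'rV[R]_n] (fun x : 'rV[R]_n => x ord0 i).
Proof.
move=> _ Y mY; rewrite setTI; apply: sub_sigma_algebra => /=.
rewrite -bigcup_seq/=; exists i => /=; first by rewrite mem_index_enum.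
by exists Y => //; rewrite setTI.
Qed.

Lemma measurable_fun_rV n (f : T -> 'rV[R]_n) :
  (forall i, measurable_fun [set: T] (fun t => f t ord0 i)) ->
  measurable_fun [set: T] f.
Proof.
move=> mf.
have : g_sigma_preimage (fun i => (fun x : 'rV[R]_n => x ord0 i) \o f)
    `<=` measurable.
  apply: smallest_sub; first exact: sigma_algebra_measurable.
  case: n => [|n] in f mf *; first by rewrite big_ord0.
  rewrite -bigcup_mkord_ord; apply: bigcup_sub => i Ii.
  by move=> A [B mB <-]; exact: mf.
by rewrite g_sigma_preimage_comp => prefS _ A mA; apply: prefS; exists A.
Qed.

End measurable_fun_rV.

(* HB does not infer the sigma-finiteness of m1 \x m2: its unification hint is
   shadowed by the one for products of subprobabilities. *)
Lemma product_measure_sigma_finite d1 d2 (T1 : measurableType d1)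
    (T2 : measurableType d2) (R : realType)
    (m1 : {sigma_finite_measure set T1 -> \bar R})
    (m2 : {sigma_finite_measure set T2 -> \bar R}) :
  sigma_finite setT (m1 \x m2)%E.
Proof.
have /sigma_finiteP[F [TF ndF Foo]] := sigma_finiteT m1.
have /sigma_finiteP[G [TG ndG Goo]] := sigma_finiteT m2.
exists (fun n => F n `*` G n).
  rewrite -setXTT TF TG predeqE => -[x y]; split.
    move=> [/= [n _ Fnx] [k _ Gky]]; exists (maxn n k) => //; split.
    - by move: x Fnx; exact/subsetPset/ndF/leq_maxl.
    - by move: y Gky; exact/subsetPset/ndG/leq_maxr.
  by move=> [n _ []/= ? ?]; split; exists n.
move=> k; have [? ?] := Foo k; have [? ?] := Goo k.
split; first exact: measurableX.
by rewrite product_measure1E// lte_mul_pinfty// ge0_fin_numE.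
Qed.

Section lebesgue_rV.
Context {R : realType}.

Definition cons_rV n (p : measurableTypeR R * 'rV[R]_n) : 'rV[R]_n.+1 :=
  \row_(i < n.+1) if unlift ord0 i is Some j then p.2 ord0 j else p.1.

Definition uncons_rV n (x : 'rV[R]_n.+1) :
    measurableTypeR R * 'rV[R]_n :=
  (x ord0 ord0, \row_(j < n) x ord0 (lift ord0 j)).

Lemma cons_rVK n : cancel (@cons_rV n) (@uncons_rV n).
Proof.
move=> [a x]; congr pair; first by rewrite mxE unlift_none.
by apply/rowP => j; rewrite !mxE liftK.
Qed.

Lemma measurable_cons_rV n : measurable_fun setT (@cons_rV n).
Proof.
apply: measurable_fun_rV => i; under eq_fun do rewrite mxE.
case: (unliftP ord0 i) => [j _|_]; last exact: measurable_fst.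
exact: (measurableT_comp (measurable_coord j) measurable_snd).
Qed.

Lemma measurable_uncons_rV n : measurable_fun setT (@uncons_rV n).
Proof.
apply: measurable_fun_pair; first exact: measurable_coord.
apply: measurable_fun_rV => j; under eq_fun do rewrite mxE.
exact: measurable_coord.
Qed.

Section cons.
Variables (n : nat) (mu : {sigma_finite_measure set 'rV[R]_n -> \bar R}).

Definition lebesgue_cons : set 'rV[R]_n.+1 -> \bar R :=
  pushforward (lebesgue_measure \x mu)%E (@cons_rV n).

Let measurable_preimage_cons (A : set 'rV[R]_n.+1) :
  measurable A -> measurable (@cons_rV n @^-1` A).
Proof.
by move=> mA; rewrite -[X in measurable X]setTI; exact: measurable_cons_rV.
Qed.

Let lebesgue_cons0 : lebesgue_cons set0 = 0%E.
Proof. by rewrite /lebesgue_cons /pushforward preimage_set0 measure0. Qed.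

Let lebesgue_cons_ge0 A : (0 <= lebesgue_cons A)%E.
Proof. by rewrite /lebesgue_cons /pushforward measure_ge0. Qed.

Let lebesgue_cons_sigma_additive : semi_sigma_additive lebesgue_cons.
Proof.
move=> F mF tF mUF; rewrite /lebesgue_cons /pushforward preimage_bigcup.
apply: measure_semi_sigma_additive.
- by move=> k; exact: measurable_preimage_cons.
- apply/trivIsetP => /= i j _ _ ij; rewrite -preimage_setI.
  by move/trivIsetP : tF => /(_ _ _ _ _ ij) ->//; rewrite preimage_set0.
- by rewrite -preimage_bigcup; exact: measurable_preimage_cons.
Qed.

HB.instance Definition _ := isMeasure.Build _ _ _ lebesgue_cons
  lebesgue_cons0 lebesgue_cons_ge0 lebesgue_cons_sigma_additive.

Let lebesgue_cons_sigma_finite : sigma_finite setT lebesgue_cons.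
Proof.
have [F FT mF] := product_measure_sigma_finite (@lebesgue_measure R) mu.
exists (fun k => @uncons_rV n @^-1` F k).
  by rewrite -preimage_bigcup -FT preimage_setT.
move=> k; have [mFk Fkoo] := mF k; split.
  by rewrite -[X in measurable X]setTI; exact: measurable_uncons_rV.
rewrite /lebesgue_cons /pushforward (_ : _ @^-1` _ = F k)//.
by apply/seteqP; split => p /=; rewrite cons_rVK.
Qed.

HB.instance Definition _ :=
  @Measure_isSigmaFinite.Build _ _ _ lebesgue_cons lebesgue_cons_sigma_finite.

End cons.

Fixpoint lebesgue_rV n : {sigma_finite_measure set 'rV[R]_n -> \bar R} :=
  if n is n'.+1 then lebesgue_cons (lebesgue_rV n') else \d_(0 : 'rV[R]_0).

Lemma lebesgue_rV_box n (A : 'I_n -> set R) : (forall i, measurable (A i)) ->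
  lebesgue_rV n [set x | forall i, A i (x ord0 i)] =
  (\prod_(i < n) lebesgue_measure (A i))%E.
Proof.
elim: n A => [|n IHn] A mA.
  by rewrite big_ord0 /= diracE mem_set//= => -[].
have mB : measurable [set x : 'rV[R]_n | forall i, A (lift ord0 i) (x ord0 i)].
  rewrite (_ : [set _ | _] = \bigcap_(i : 'I_n)
      ((fun x : 'rV[R]_n => x ord0 i) @^-1` A (lift ord0 i))).
    apply: fin_bigcap_measurable => // i _.
    by rewrite -[X in measurable X]setTI; exact: measurable_coord.
  by apply/seteqP; split => x /= h i; [move=> _; exact: h|exact: h].
rewrite big_ord_recl -IHn// -product_measure1E//; last exact: (mA ord0).
rewrite /= /lebesgue_cons /pushforward; congr (_ _).
apply/seteqP; split=> -[a x] /=.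
  move=> h; split=> [|i]; first by have := h ord0; rewrite mxE unlift_none.
  by have := h (lift ord0 i); rewrite mxE liftK.
move=> [Aa Ax] i; rewrite mxE; case: unliftP => [j ->|->//]; exact: Ax.
Qed.

End lebesgue_rV.
Arguments lebesgue_rV : clear implicits.

Section time_frequency.
Variables (R : realType) (d : nat).

Local Notation C := R[i].
Local Notation Re := (@complex.Re R).
Local Notation Im := (@complex.Im R).
Local Notation Rd := 'rV[R]_d.
Local Notation Z := (Rd * Rd)%type.
Local Notation mu := (lebesgue_rV R d).
Local Notation muZ := (mu \x mu)%E.

Implicit Types (psi phi f g : Rd -> C) (S T : (Rd -> C) -> Rd -> C).
Implicit Types (z : Z) (A Omega : set Z).

Definition dot (x w : Rd) : R := \sum_i x ord0 i * w ord0 i.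

Definition expi (theta : R) : C := cos theta +i* sin theta.

Definition Cintegral disp (X : measurableType disp)
    (nu : {measure set X -> \bar R}) (D : set X) (F : X -> C) : C :=
  (\int[nu]_(x in D) Re (F x))%R +i* (\int[nu]_(x in D) Im (F x))%R.

Definition Ccvg (u : nat -> C) (l : C) : Prop :=
  (Re \o u @ \oo --> Re l) /\ (Im \o u @ \oo --> Im l).

(* Elements of L^2(R^d) are represented by square integrable functions, and
   equality in L^2(R^d) is equality almost everywhere. *)

Definition L2norm f : \bar R :=
  Lnorm mu 2%:E (fun t => (ComplexField.Normc.normc (f t))%:E).

Definition L2 f : Prop :=
  [/\ measurable_fun setT (Re \o f), measurable_fun setT (Im \o f)
    & (L2norm f < +oo)%E].

Definition inner f g : C := Cintegral mu setT (fun t => f t * (g t)^*).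

Definition L2cvg (u : nat -> Rd -> C) f : Prop :=
  (fun N => L2norm (u N \- f)) @ \oo --> (0 : \bar R).

(* A bounded operator on L^2(R^d) acts on representatives; its values outside
   of L2 are irrelevant. *)
Definition bounded_operator T : Prop :=
  [/\ forall f, L2 f -> L2 (T f),
      forall f g, L2 f -> L2 g -> f = g %[ae mu] -> T f = T g %[ae mu],
      forall (a : C) f g, L2 f -> L2 g ->
        T (fun t => a * f t + g t) = (fun t => a * T f t + T g t) %[ae mu]
    & exists M : R, forall f, L2 f -> (L2norm (T f) <= M%:E * L2norm f)%E].

(* The Schatten class S^1: S is the sum of a singular value decomposition
   sum_n s_n <., eta_n> xi_n, with (xi_n) and (eta_n) orthonormal and (s_n)
   summable. The orthonormality is only required at the indices n with
   s_n <> 0, so that finite rank operators are included in all dimensions. *)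
Definition trace_class S : Prop :=
  bounded_operator S /\
  exists (s : nat -> R) (xi eta : nat -> Rd -> C),
    [/\ forall n, 0 <= s n,
        cvgn (series s),
        forall n, L2 (xi n) /\ L2 (eta n),
        forall m n, s m != 0 -> s n != 0 ->
          inner (xi m) (xi n) = (m == n)%:R /\
          inner (eta m) (eta n) = (m == n)%:R
      & forall f, L2 f ->
          L2cvg (fun N t => \sum_(n < N) (s n)%:C * inner f (eta n) * xi n t)
            (S f)].

(* Orthonormal bases are indexed by nat: L^2(R^d) is separable and, for d > 0,
   infinite-dimensional. *)
Definition orthonormal_basis (e : nat -> Rd -> C) : Prop :=
  [/\ forall n, L2 (e n),
      forall m n, inner (e m) (e n) = (m == n)%:R
    & forall f, L2 f ->
        L2cvg (fun N t => \sum_(n < N) inner f (e n) * e n t) f].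

(* For a trace class S the sum does not depend on the orthonormal basis. *)
Definition trace S : C :=
  xget 0 [set t | exists e, orthonormal_basis e /\
    Ccvg (fun N => \sum_(n < N) inner (S (e n)) (e n)) t].

Definition tfshift z psi : Rd -> C :=
  fun t => expi (2 * pi * dot z.2 t) * psi (t - z.1).

(* The adjoint, which is the inverse, of the unitary operator tfshift z. *)
Definition tfshift_adj z psi : Rd -> C :=
  fun t => expi (- (2 * pi * dot z.2 (t + z.1))) * psi (t + z.1).

Definition alpha z S : (Rd -> C) -> Rd -> C :=
  fun psi => tfshift z (S (tfshift_adj z psi)).

Definition STFT phi psi z : C := inner psi (tfshift z phi).

Definition cross_ambiguity psi phi z : C :=
  expi (pi * dot z.1 z.2) * STFT phi psi z.

Definition Fourier_Wigner S z : C :=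
  expi (- (pi * dot z.1 z.2)) * trace (fun psi => tfshift (- z) (S psi)).

Definition chi Omega z : C := (\1_Omega z)%:C.

(* T = F \star S, the operator defined weakly by the integral of
   F(z) <alpha_z(S) psi, phi>. Such a T is unique as an operator on L^2. *)
Definition is_convolution (F : Z -> C) S T : Prop :=
  bounded_operator T /\
  forall psi phi, L2 psi -> L2 phi ->
    inner (T psi) phi =
    Cintegral muZ setT (fun z => F z * inner (alpha z S psi) phi).

(* T = A_Omega^{phi1,phi2}, again defined weakly. *)
Definition is_localization Omega phi1 phi2 T : Prop :=
  bounded_operator T /\
  forall psi phi, L2 psi -> L2 phi ->
    inner (T psi) phi =
    Cintegral muZ Omega
      (fun z => STFT phi1 psi z * inner (tfshift z phi2) phi).

(* Lebesgue measurable sets of finite measure are the Borel sets of finite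
   measure up to a subset of a Borel null set. For such an Omega the integrals
   above coincide with the integrals over the Borel set B. *)
Definition finite_Lebesgue_measure Omega : Prop :=
  exists B : set Z,
    [/\ measurable B, (muZ B < +oo)%E & muZ.-negligible (Omega `+` B)].

End time_frequency.

(* Main.v *)
Require Import Defs.
From HB Require Import structures.
From mathcomp Require Import all_boot all_order all_algebra.
From mathcomp Require Import all_classical all_reals all_analysis.
From mathcomp Require Import measurable_realfun ring lra.
From mathcomp Require Import complex.

Set Implicit Arguments.
Unset Strict Implicit.
Unset Printing Implicit Defensive.
Import Order.TTheory GRing.Theory Num.Theory.
Import numFieldNormedType.Exports.

Local Open Scope classical_set_scope.
Local Open Scope ring_scope.
Local Open Scope complex_scope.

(* Let f = 1_Omega - 1_Omega'. By hypothesis the form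
   int f(z) <alpha_z(S) u, v> dz vanishes. Summing it over u = e_n and
   v = pi(-zeta)^* e_n, for (e_n) a resolution of the identity, gives
   tr(pi(-zeta) S) * int f(z) exp(-2 i pi sigma(zeta, z)) dz = 0, because
   pi(-zeta) pi(z) and pi(z) pi(-zeta) differ by a phase. So the symplectic
   Fourier transform of f vanishes where F_W(S) does not, hence everywhere by
   density and dominated convergence. In part (2), S = <., phi1> phi2.

   Fourier uniqueness needs no inversion formula. Call g annihilated when
   f g is orthogonal to all trigonometric functions, and m a multiplier when
   g m is annihilated whenever g is. The multipliers form an algebra stable
   under bounded pointwise limits which contains the trigonometric functions.
   Since sgr (sin ((z_j - b) / n)) tends to sgr (z_j - b), it contains the
   indicator functions of half-spaces, hence of all Borel sets.

   The resolution of the identity consists of the normalized indicator functions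
   of the atoms of an increasing sequence of finite algebras of sets. *)

Import HBNNSimple.

(** * Integration *)

(** The trace in [Fourier_Wigner] refers to some unspecified orthonormal basis, whereas the
    vanishing form has to be summed over vectors at hand. The link is a number in which no basis
    occurs, the sum over [k] of [s k * <pi(- zeta) xi_k, eta_k>], read off from a nuclear expansion
    of [S]. Every family with Bessel's inequality and a weak Parseval identity computes it, and
    these two properties make up [resolution]; so the atoms may change with [N] instead of being
    orthonormalized into a basis. The price is an exchange of the limits in [N] and [k]. Bessel's
    inequality provides a majorant that is summable in [k] and uniform in both [N] and [z]; the same
    bound then allows dominated convergence over phase space.

    The matrix coefficients of [alpha z S] are treated only as bounded functions of [z]. For this
    reason [f] is never formed: its integrals are kept as differences of integrals over two Borel
    sets of finite measure, where boundedness gives integrability. *)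

Section integral_null.
Context disp (X : measurableType disp) (R : realType).
Variable nu : {measure set X -> \bar R}.

(** The integral of a nonnegative function is a supremum over the simple functions below it. A
    simple function below [f], set to zero on [N], keeps its integral and lies below [g]. *)
Lemma le_integral_off_null (N : set X) (f g : X -> \bar R) :
  measurable N -> nu N = 0%E ->
  (forall x, 0 <= f x)%E -> (forall x, 0 <= g x)%E ->
  (forall x, ~ N x -> f x = g x) ->
  (\int[nu]_x f x <= \int[nu]_x g x)%E.
Proof.
move=> mN N0 f0 g0 fg; rewrite ge0_integralTE// ge0_integralTE//.
apply: ge_ereal_sup => _ [h hf <-].
have mNc := measurableC mN.
apply: (@le_trans _ _ (sintegral nu (mul_nnsfun h (indic_nnsfun R mNc)))).
  rewrite -!integralT_nnsfun le_eqVlt; apply/orP; left; apply/eqP.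
  apply: ge0_ae_eq_integral => //.
  - exact/measurable_EFinP.
  - exact/measurable_EFinP.
  - by move=> x _; rewrite lee_fin.
  - by move=> x _; rewrite lee_fin.
  exists N; split => // x /= /not_implyP[_ hx]; apply: contrapT => Nx; apply: hx.
  by rewrite /= ?mindicE mem_set// mulr1.
apply: ereal_sup_ubound; exists (mul_nnsfun h (indic_nnsfun R mNc)) => // x /=.
rewrite ?mindicE; have [xN|xN] := boolP (x \in ~` N).
  by rewrite mulr1 -fg; [exact: hf|exact/set_mem].
by rewrite mulr0.
Qed.

(* The functions are not assumed measurable: the masks are the indicator
   functions of sets that are only Lebesgue measurable. *)
Lemma eq_integral_off_null (N : set X) (f g : X -> \bar R) :
  measurable N -> nu N = 0%E -> (forall x, ~ N x -> f x = g x) ->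
  (\int[nu]_x f x = \int[nu]_x g x)%E.
Proof.
move=> mN N0 fg; rewrite integralE [RHS]integralE.
by congr (_ - _)%E; apply/eqP; rewrite eq_le; apply/andP; split;
  apply: (le_integral_off_null mN N0) => // x Nx;
  rewrite ?funeposE ?funenegE fg.
Qed.

End integral_null.

Section bounded_convergence.
Context disp (X : measurableType disp) (R : realType).
Variable nu : {measure set X -> \bar R}.

Lemma Rintegral_dominated (D : set X) (f_ : nat -> X -> R) (f g : X -> R) :
  measurable D -> (forall n, measurable_fun D (f_ n)) ->
  (forall x, D x -> f_ ^~ x @ \oo --> f x) ->
  nu.-integrable D (EFin \o g) ->
  (forall n x, D x -> `|f_ n x| <= g x) ->
  nu.-integrable D (EFin \o f) /\
  (\int[nu]_(x in D) f_ n x)%R @[n --> \oo] --> (\int[nu]_(x in D) f x)%R.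
Proof.
move=> mD mf_ f_f ig f_g.
have mf : measurable_fun D f by exact: measurable_fun_cvg f_f.
have [] := @dominated_convergence _ _ _ nu D mD (fun n => EFin \o f_ n) (EFin \o f)
  (EFin \o g).
- by move=> n; exact/measurable_EFinP.
- exact/measurable_EFinP.
- apply/aeW => x Dx; apply: cvg_EFin; first exact: nearW.
  exact: f_f.
- exact: ig.
- by apply/aeW => x n Dx; rewrite lee_fin; exact: f_g.
move=> intf _ intcvg; split => //.
apply: fine_cvg => /=; rewrite fineK//; exact: integrable_fin_num.
Qed.

End bounded_convergence.

Lemma cvgn_le_ubound (R : realType) (u : nat -> R) (l C : R) :
  (forall n, u n <= C) -> u @ \oo --> l -> l <= C.
Proof.
move=> uC ul; rewrite -(cvg_lim (@Rhausdorff R) ul).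
by apply: limr_le; [apply/cvg_ex; exists l|exact: nearW].
Qed.

Lemma cvgn_sum (R : realType) (I : Type) (r : seq I) (u : I -> nat -> R)
    (l : I -> R) : (forall i, u i @ \oo --> l i) ->
  (\sum_(i <- r) u i n) @[n --> \oo] --> \sum_(i <- r) l i.
Proof.
move=> ul; elim: r => [|i r IH].
  by rewrite big_nil; under eq_fun do rewrite big_nil; exact: cvg_cst.
by rewrite big_cons; under eq_fun do rewrite big_cons; exact: cvgD.
Qed.

(** * Multipliers of the annihilated functions *)

Section bounded_measurable.
Context disp (X : measurableType disp) (R : realType).
Implicit Types f g : X -> R.

Definition bmeas g :=
  measurable_fun setT g /\ exists M, forall x, `|g x| <= M.

Lemma bmeas_cst r : bmeas (cst r).
Proof. by split; [exact: measurable_cst|exists `|r|]. Qed.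

Lemma bmeasD f g : bmeas f -> bmeas g -> bmeas (fun x => f x + g x).
Proof.
move=> [mf [M hM]] [mg [N hN]]; split; first exact: measurable_funD.
by exists (M + N) => x; rewrite (le_trans (ler_normD _ _))// lerD.
Qed.

Lemma bmeasM f g : bmeas f -> bmeas g -> bmeas (fun x => f x * g x).
Proof.
move=> [mf [M hM]] [mg [N hN]]; split; first exact: measurable_funM.
by exists (M * N) => x; rewrite normrM ler_pM.
Qed.

Lemma bmeas_lim (g_ : nat -> X -> R) g C :
  (forall n, bmeas (g_ n)) -> (forall n x, `|g_ n x| <= C) ->
  (forall x, g_ ^~ x @ \oo --> g x) -> bmeas g.
Proof.
move=> mg hC cvg; split.
  by apply: (@measurable_realfun.measurable_fun_cvg _ _ _ _ g_) => // n; have [] := mg n.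
exists C => x; apply: (@cvgn_le_ubound _ (fun n => `|g_ n x|)) => //.
exact: cvg_norm.
Qed.

Variable nu : {measure set X -> \bar R}.

Lemma bmeas_integrable (D : set X) g : measurable D -> (nu D < +oo)%E ->
  bmeas g -> nu.-integrable D (EFin \o g).
Proof.
move=> mD Doo [mg [M hM]]; apply: measurable_bounded_integrable => //.
  exact: measurable_funTS.
by exists M; split; [exact: num_real|move=> y My x _; exact: le_trans (hM x) (ltW My)].
Qed.

Variables (B B' : set X).
Hypotheses (mB : measurable B) (mB' : measurable B').
Hypotheses (Boo : (nu B < +oo)%E) (Boo' : (nu B' < +oo)%E).

(** The integral of [g] against [\1_B - \1_B']. As a difference of integrals over sets of finite
    measure it makes sense for every bounded measurable [g]. *)
Definition int_diff g : R :=
  (\int[nu]_(x in B) g x)%R - (\int[nu]_(x in B') g x)%R.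

Lemma int_diffD f g : bmeas f -> bmeas g ->
  int_diff (fun x => f x + g x) = int_diff f + int_diff g.
Proof.
move=> bf bg; rewrite /int_diff !RintegralD//; try exact: bmeas_integrable.
lra.
Qed.

Lemma int_diffZ r g : bmeas g -> int_diff (fun x => r * g x) = r * int_diff g.
Proof.
move=> bg; rewrite /int_diff !RintegralZl//; try exact: bmeas_integrable.
lra.
Qed.

Lemma int_diff_lim (g_ : nat -> X -> R) g C :
  (forall n, bmeas (g_ n)) -> (forall n x, `|g_ n x| <= C) ->
  (forall x, g_ ^~ x @ \oo --> g x) ->
  int_diff (g_ n) @[n --> \oo] --> int_diff g.
Proof.
move=> mg hC cvg.
have H (D : set X) : measurable D -> (nu D < +oo)%E ->
    (\int[nu]_(x in D) g_ n x)%R @[n --> \oo] --> (\int[nu]_(x in D) g x)%R.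
  move=> mD Doo; have [] // := @Rintegral_dominated _ _ _ nu D g_ g (cst C).
  - by move=> n; apply: measurable_funTS; have [] := mg n.
  - by apply: bmeas_integrable => //; exact: bmeas_cst.
by apply: cvgB; exact: H.
Qed.

Lemma int_diff_lim0 (g_ : nat -> X -> R) g C :
  (forall n, bmeas (g_ n)) -> (forall n x, `|g_ n x| <= C) ->
  (forall x, g_ ^~ x @ \oo --> g x) ->
  (forall n, int_diff (g_ n) = 0) -> int_diff g = 0.
Proof.
move=> bg hC gcvg g0; have := int_diff_lim bg hC gcvg.
by under eq_fun do rewrite g0; move/cvg_lim; rewrite lim_cst// => <-.
Qed.

(** The [c k] stand for the trigonometric functions, and [cM] for the product-to-sum formula. *)
Variables (K : Type) (c : K -> X -> R).
Hypothesis bc : forall k, bmeas (c k).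
Hypothesis cM : forall k l, exists a b, forall x,
  c k x * c l x = 2^-1 * (c a x + c b x).

Definition annihilated g :=
  bmeas g /\ forall k, int_diff (fun x => g x * c k x) = 0.

(** Quantifying over every annihilated [g] makes a product of multipliers a multiplier, by
    composition. *)
Definition multiplier m :=
  bmeas m /\ forall g, annihilated g -> annihilated (fun x => g x * m x).

Lemma multiplier_cst r : multiplier (cst r).
Proof.
split=> [|g [bg g0]]; first exact: bmeas_cst.
split=> [|k]; first by apply: bmeasM => //; exact: bmeas_cst.
under [X in int_diff X]eq_fun do rewrite mulrAC mulrC.
by rewrite int_diffZ ?g0 ?mulr0//; exact: bmeasM.
Qed.

Lemma multiplierD m1 m2 : multiplier m1 -> multiplier m2 ->
  multiplier (fun x => m1 x + m2 x).
Proof.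
move=> [b1 h1] [b2 h2]; split=> [|g ag]; first exact: bmeasD.
have [[bg1 g1] [bg2 g2]] := (h1 _ ag, h2 _ ag); have [bg _] := ag.
split=> [|k]; first by apply: bmeasM => //; exact: bmeasD.
under [X in int_diff X]eq_fun do rewrite mulrDr mulrDl.
by rewrite int_diffD ?g1 ?g2 ?addr0//; exact: bmeasM.
Qed.

Lemma multiplierM m1 m2 : multiplier m1 -> multiplier m2 ->
  multiplier (fun x => m1 x * m2 x).
Proof.
move=> [b1 h1] [b2 h2]; split=> [|g ag]; first exact: bmeasM.
under eq_fun do rewrite mulrA.
exact/h2/h1.
Qed.

Lemma multiplierZ r m : multiplier m -> multiplier (fun x => r * m x).
Proof. by apply: multiplierM; exact: multiplier_cst. Qed.

Lemma multiplierB m1 m2 : multiplier m1 -> multiplier m2 ->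
  multiplier (fun x => m1 x - m2 x).
Proof.
move=> h1 h2; under eq_fun do rewrite -(mulN1r (m2 _)).
by apply: multiplierD => //; exact: multiplierZ.
Qed.

Lemma multiplier_lim (m_ : nat -> X -> R) m C :
  (forall n, multiplier (m_ n)) -> (forall n x, `|m_ n x| <= C) ->
  (forall x, m_ ^~ x @ \oo --> m x) -> multiplier m.
Proof.
move=> hm hC mcvg.
have bm : bmeas m by apply: bmeas_lim hC mcvg => n; have [] := hm n.
split => // g ag; have [[bg1 [G hG]] _] := ag; have [bg _] := ag.
split=> [|k]; first exact: bmeasM.
have [bck [N hN]] := bc k.
apply: (@int_diff_lim0 (fun n x => g x * m_ n x * c k x) _ (G * C * N)).
- by move=> n; do 2 apply: bmeasM => //; have [] := hm n.
- by move=> n x; rewrite !normrM !ler_pM// mulr_ge0.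
- move=> x; apply: cvgM; last exact: cvg_cst.
  by apply: cvgM; [exact: cvg_cst|exact: mcvg].
- by move=> n; have [_ /(_ g ag)[_]] := hm n; apply.
Qed.

(** By [cM], testing [g * c k] against [c l] amounts to averaging two tests of [g]. *)
Lemma multiplier_test k : multiplier (c k).
Proof.
split => // g [bg g0]; split=> [|l]; first exact: bmeasM.
have [a [b ab]] := cM k l.
under [X in int_diff X]eq_fun do rewrite -mulrA ab mulrCA mulrDr.
rewrite int_diffZ; last by apply: bmeasD; exact: bmeasM.
by rewrite int_diffD ?g0 ?addr0 ?mulr0//; exact: bmeasM.
Qed.

(* The Newton-Schulz iteration [p |-> (3 p - p^3) / 2] converges to [sgr]
   on [-1, 1], which it preserves. *)
Fixpoint sgr_approx (n : nat) (s : R) : R :=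
  if n is n'.+1 then
    let p := sgr_approx n' s in 2^-1 * (3 * p - p * p * p)
  else s.

Lemma sgr_approxN n s : sgr_approx n (- s) = - sgr_approx n s.
Proof. by elim: n => //= n ->; ring. Qed.

(** One step multiplies the error [1 - p] by [(1 - p) (2 + p) / 2 = 1 - (p + p ^ 2) / 2]. This is at
    most [1 - s / 2], because the iterates stay above their starting point [s]. *)
Lemma sgr_approx_bound n s : 0 < s -> s <= 1 ->
  [/\ s <= sgr_approx n s, sgr_approx n s <= 1 &
      1 - sgr_approx n s <= (1 - 2^-1 * s) ^+ n].
Proof.
move=> s0 s1; elim: n => [|n [h1 h2 h3]] /=.
  by split; rewrite // expr0; lra.
set p := sgr_approx n s in h1 h2 h3 *.
have E1 : 2^-1 * (3 * p - p * p * p) - p = 2^-1 * (p * (1 - p) * (1 + p)).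
  by field.
have E2 : 1 - 2^-1 * (3 * p - p * p * p) = (1 - p) * ((1 - p) * (2 + p) * 2^-1).
  by field.
split.
- rewrite (le_trans h1)// -subr_ge0 E1 !mulr_ge0//; lra.
- rewrite -subr_ge0 E2 !mulr_ge0//; lra.
rewrite exprS; apply: (@le_trans _ _ ((1 - 2^-1 * s) * (1 - p))); last first.
  by rewrite ler_wpM2l//; lra.
rewrite E2 mulrC ler_wpM2r//; first lra.
nra.
Qed.

Lemma sgr_approx_cvg s : `|s| <= 1 -> sgr_approx ^~ s @ \oo --> Num.sg s.
Proof.
wlog s0 : s / 0 <= s => [h|] s1.
  have [/h|s0] := leP 0 s; first exact.
  have {}h := h (- s); rewrite normrN oppr_ge0 (ltW s0) in h.
  rewrite -[s]opprK; under eq_fun do rewrite sgr_approxN.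
  rewrite sgrN; apply: cvgN; exact: h.
move: s0; rewrite le_eqVlt => /predU1P[<-|s0].
  have E n : sgr_approx n 0 = 0 by elim: n => //= n ->; ring.
  by under eq_fun do rewrite E; rewrite sgr0; exact: cvg_cst.
rewrite gtr0_sg//; have {}s1 : s <= 1 by rewrite (le_trans _ s1)// ler_norm.
have H n := sgr_approx_bound n s0 s1.
apply: (@squeeze_cvgr _ _ _ _ (fun n => 1 - (1 - 2^-1 * s) ^+ n) (cst 1)).
- by near=> n; have [_ h h'] := H n; rewrite h andbT; lra.
- rewrite -[X in _ --> X]subr0; apply: cvgB; first exact: cvg_cst.
  apply: cvg_expr; rewrite ger0_norm; lra.
- exact: cvg_cst.
Unshelve. all: by end_near. Qed.

Lemma multiplier_sgr m : multiplier m -> (forall x, `|m x| <= 1) ->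
  multiplier (fun x => Num.sg (m x)).
Proof.
move=> hm m1; apply: (@multiplier_lim (fun n x => sgr_approx n (m x)) _ 1).
- elim=> //= n IH; apply: multiplierZ; apply: multiplierB.
    exact: multiplierZ.
  by do 2 apply: multiplierM => //.
- move=> n x; have [s0|s0|<-] := ltrgtP 0 (m x).
  + have [|h1 h2 _] := @sgr_approx_bound n (m x) s0.
      by rewrite (le_trans _ (m1 x))// ler_norm.
    by rewrite ger0_norm//; lra.
  + have [||h1 h2 _] := @sgr_approx_bound n (- m x); first lra.
      by rewrite (le_trans _ (m1 x))// -normrN ler_norm.
    by rewrite -normrN -sgr_approxN ger0_norm//; lra.
  + have -> : sgr_approx n 0 = 0 by elim: n => //= n ->; ring.
    by rewrite normr0.
- by move=> x; exact: sgr_approx_cvg.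
Qed.

Definition multiplier_sets : set (set X) :=
  [set A | measurable A /\ multiplier \1_A].

Lemma sigma_algebra_multiplier : sigma_algebra setT multiplier_sets.
Proof.
have HC A : multiplier_sets A -> multiplier_sets (~` A).
  move=> [mA hA]; split; first exact: measurableC.
  suff -> : \1_(~` A) = (fun x => 1 - \1_A x) :> (X -> R).
    by apply: multiplierB => //; exact: multiplier_cst.
  by apply/funext => x; rewrite !indicE in_setC; case: (_ \in _); rewrite /= ?subrr ?subr0.
split.
- split => //; rewrite indic0; exact: multiplier_cst.
- by move=> A hA; rewrite setTD; exact: HC.
move=> F hF; have hG n := HC _ (hF n).
(* Complements turn the countable union into a countable intersection, whose indicator function is
   the pointwise limit of the finite products [p n]. *)
rewrite -[\bigcup_k _]setCK; apply: HC; rewrite setC_bigcup.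
split; first by apply: bigcap_measurable => // n _; have [] := hG n.
pose p (n : nat) x : R := \prod_(i < n) \1_(~` F i) x.
have hp n x : 0 <= p n x <= 1.
  apply/andP; split; [apply: prodr_ge0|apply: prodr_ile1];
    by move=> i _; rewrite indicE; case: (_ \in _) => /=; rewrite ?lexx ?ler01.
apply: (@multiplier_lim p _ 1).
- elim=> [|n IH].
    rewrite (_ : p 0%N = cst 1); first exact: multiplier_cst.
    by apply/funext => x; rewrite /p big_ord0.
  rewrite (_ : p n.+1 = fun x => p n x * \1_(~` F n) x).
    by apply: multiplierM => //; have [] := hG n.
  by apply/funext => x; rewrite /p big_ord_recr.
- by move=> n x; have /andP[h0 h1] := hp n x; rewrite ger0_norm.
- move=> x; rewrite indicE; have [|] := boolP (x \in _).
    move=> /set_mem /= xF; rewrite [p ^~ x](_ : _ = cst 1); first exact: cvg_cst.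
    by apply/funext => n; rewrite /p big1// => i _; rewrite indicE mem_set//; exact: xF.
  rewrite notin_setE /= => /existsNP[k /not_implyP[_ xk]].
  apply: cvg_near_cst; exists k.+1 => // n /= kn.
  by apply/eqP; rewrite /p (bigD1 (Ordinal kn))//= indicE memNset ?mul0r.
Qed.

End bounded_measurable.

(** * Uniqueness of the Fourier transform *)

Section sigma_algebra_rays.
Variable R : realType.

(** The sets whose preimage lies in [S] form a sigma-algebra, so that generators suffice: first
    preimages by coordinates, then rays of the real line. The map [p] will be a projection of phase
    space and, in the density argument, the identity. *)
Lemma sigma_algebra_preimage_rV (T : Type) (S : set (set T)) n
    (p : T -> 'rV[R]_n) : sigma_algebra setT S ->
  (forall (i : 'I_n) b, S [set t | b < p t ord0 i]) ->
  forall A, measurable A -> S (p @^-1` A).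
Proof.
move=> saS rays A mA; rewrite -[_ @^-1` _]setTI.
suff : measurable `<=` image_set_system setT p S by exact.
apply: smallest_sub; first exact: sigma_algebra_image.
rewrite -bigcup_seq => _ [i _ [Y mY <-]] /=; rewrite /image_set_system/= setTI.
suff : measurable `<=` image_set_system setT (fun t => p t ord0 i) S.
  exact.
rewrite [X in X `<=` _](RGenOInfty.measurableE R); apply: smallest_sub.
  exact: sigma_algebra_image.
move=> _ [b ->]; rewrite /image_set_system/= setTI.
rewrite (_ : _ @^-1` _ = [set t | b < p t ord0 i]); first exact: rays.
by apply/seteqP; split => t /=; rewrite in_itv/= andbT.
Qed.

Lemma sigma_algebra_prod_rV n (S : set (set ('rV[R]_n * 'rV[R]_n))) :
  sigma_algebra setT S ->
  (forall (i : 'I_n) b, S [set z : 'rV[R]_n * 'rV[R]_n | b < z.1 ord0 i]) ->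
  (forall (i : 'I_n) b, S [set z : 'rV[R]_n * 'rV[R]_n | b < z.2 ord0 i]) ->
  measurable `<=` S.
Proof.
move=> saS rays1 rays2; apply: smallest_sub => // _ [|] [A mA <-]; rewrite setTI;
  exact: sigma_algebra_preimage_rV.
Qed.

End sigma_algebra_rays.

Section trigonometric_uniqueness.
Variables (R : realType) (d : nat).
Local Notation Z := ('rV[R]_d * 'rV[R]_d)%type.
Local Notation muZ := (lebesgue_rV R d \x lebesgue_rV R d)%E.

Definition sympl (zeta z : Z) : R := dot zeta.2 z.1 - dot zeta.1 z.2.

Lemma dotDl (x y w : 'rV[R]_d) : dot (x + y) w = dot x w + dot y w.
Proof. by rewrite -big_split/=; apply: eq_bigr => i _; rewrite mxE mulrDl. Qed.

Lemma dotNl (x w : 'rV[R]_d) : dot (- x) w = - dot x w.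
Proof. by rewrite -sumrN; apply: eq_bigr => i _; rewrite mxE mulNr. Qed.

Lemma dotC (x w : 'rV[R]_d) : dot x w = dot w x.
Proof. by apply: eq_bigr => i _; rewrite mulrC. Qed.

Lemma dot0l (w : 'rV[R]_d) : dot 0 w = 0.
Proof. by apply: big1 => i _; rewrite mxE mul0r. Qed.

Lemma dot_delta (j : 'I_d) (a : R) (w : 'rV[R]_d) :
  dot (\row_i (a *+ (i == j))) w = a * w ord0 j.
Proof.
rewrite /dot (bigD1 j)//= mxE eqxx mulr1n big1 ?addr0// => i ij.
by rewrite mxE (negbTE ij) mulr0n mul0r.
Qed.

Lemma symplDl (z1 z2 z : Z) : sympl (z1 + z2) z = sympl z1 z + sympl z2 z.
Proof. rewrite /sympl !dotDl; lra. Qed.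

Lemma symplNl (z1 z : Z) : sympl (- z1) z = - sympl z1 z.
Proof. rewrite /sympl !dotNl; lra. Qed.

Lemma measurable_dot (x : 'rV[R]_d) :
  measurable_fun setT (dot x).
Proof.
apply: measurable_sum => i; apply: measurable_funM => //.
exact: measurable_coord.
Qed.

(** The phase [k.2] puts cosines and sines into one family, to which a single product-to-sum formula
    applies. *)
Definition trig (k : Z * R) (z : Z) : R := cos (2 * pi * sympl k.1 z + k.2).

Lemma bmeas_trig k : bmeas (trig k).
Proof.
split; last by exists 1 => z; rewrite ler_norml cos_geN1 cos_le1.
apply: (measurableT_comp (continuous_measurable_fun (@continuous_cos R))).
apply: measurable_funD => //; apply: measurable_funM => //.
apply: measurable_funB.
  exact: (measurableT_comp (measurable_dot _) measurable_fst).
exact: (measurableT_comp (measurable_dot _) measurable_snd).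
Qed.

Lemma trigM k l : exists a b, forall z,
  trig k z * trig l z = 2^-1 * (trig a z + trig b z).
Proof.
exists (k.1 + l.1, k.2 + l.2), (k.1 - l.1, k.2 - l.2) => z.
rewrite /trig /= !symplDl symplNl.
set x := 2 * pi * sympl k.1 z + k.2; set y := 2 * pi * sympl l.1 z + l.2.
have -> : 2 * pi * (sympl k.1 z + sympl l.1 z) + (k.2 + l.2) = x + y.
  by rewrite /x /y; ring.
have -> : 2 * pi * (sympl k.1 z - sympl l.1 z) + (k.2 - l.2) = x - y.
  by rewrite /x /y; ring.
by rewrite (cosD x y) (cosB x y); field.
Qed.

(** As soon as [n.+1] exceeds [|y| / pi], the sine has the sign of [y], so the sequence is
    eventually constant. *)
Lemma sgr_sin_cvg (y : R) :
  (fun n => Num.sg (sin (y / n.+1%:R))) @ \oo --> Num.sg y.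
Proof.
wlog y0 : y / 0 <= y => [h|].
  have [/h|y0] := leP 0 y; first exact.
  have {}h := h (- y); rewrite oppr_ge0 (ltW y0) in h.
  rewrite -[y]opprK; under eq_fun do rewrite mulNr sinN sgrN.
  rewrite sgrN; apply: cvgN; exact: h.
move: y0; rewrite le_eqVlt => /predU1P[<-|y0].
  under eq_fun do rewrite mul0r sin0; exact: cvg_cst.
apply: cvg_near_cst.
have : (fun n => y * n.+1%:R^-1) @ \oo --> y * 0.
  by apply: cvgM; [exact: cvg_cst|exact: cvg_harmonic].
rewrite mulr0 => /cvgr_lt /(_ pi (pi_gt0 R)); apply: filterS => n hn.
apply/eqP; rewrite !gtr0_sg//; apply: sin_gt0_pi; rewrite hn andbT.
by rewrite divr_gt0.
Qed.

Variables (B B' : set Z).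
Hypotheses (mB : measurable B) (mB' : measurable B').
Hypotheses (Boo : (muZ B < +oo)%E) (Boo' : (muZ B' < +oo)%E).
Local Notation multiplier := (multiplier muZ B B' trig).

Lemma multiplier_ray (x : Z -> R) :
  measurable_fun setT x ->
  (forall a, exists zeta, forall z, 2 * pi * sympl zeta z = a * x z) ->
  forall b, multiplier (\1_[set z | b < x z]).
Proof.
move=> mx hx b.
have hs : multiplier (fun z => Num.sg (x z - b)).
  apply: (@multiplier_lim _ _ _ _ _ _ mB mB' Boo Boo' _ _ bmeas_trig
    (fun n z => Num.sg (sin ((x z - b) / n.+1%:R))) _ 1).
  - move=> n; apply: multiplier_sgr => //.
    + exact: bmeas_trig.
    + have [zeta hz] := hx (n.+1%:R^-1).
      (* The shift by [- pi / 2] turns the sine into a cosine, and [b] enters through the phase. *)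
      rewrite (_ : (fun _ => _) = trig (zeta, - (b / n.+1%:R) - pi / 2)).
        by apply: multiplier_test => //; [exact: bmeas_trig|exact: trigM].
      apply/funext => z; rewrite /trig/= hz -cosBpihalf; congr cos; ring.
    + by move=> z; rewrite ler_norml sin_geN1 sin_le1.
  - by move=> n z; rewrite normr_sg; case: (_ != _); rewrite ?lexx ?ler01.
  - by move=> z; exact: sgr_sin_cvg.
(* The polynomial [(s + s ^ 2) / 2] sends the signs 1, 0, -1 to 1, 0, 0, as the open half-space
   requires. *)
rewrite (_ : \1_ _ = fun z => 2^-1 * (Num.sg (x z - b) + Num.sg (x z - b) * Num.sg (x z - b))).
  apply: (multiplierZ mB mB' Boo Boo' bmeas_trig).
  apply: (multiplierD mB mB' Boo Boo' bmeas_trig) => //.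
  exact: multiplierM.
apply/funext => z; rewrite indicE.
have [/set_mem/= bx|] := boolP (z \in _).
  by rewrite gtr0_sg ?subr_gt0//; field.
rewrite notin_setE/= => /negP; rewrite -leNgt le_eqVlt => /predU1P[->|xb]; first by rewrite subrr sgr0; field.
by rewrite ltr0_sg ?subr_lt0//; field.
Qed.

Lemma multiplier_measurable (A : set Z) : measurable A -> multiplier \1_A.
Proof.
have saS := sigma_algebra_multiplier mB mB' Boo Boo' bmeas_trig.
have pi0 : 2 * pi != 0 :> R by rewrite mulf_neq0// gt_eqF// pi_gt0.
have m1 (i : 'I_d) : measurable_fun setT (fun z : Z => z.1 ord0 i).
  exact: (measurableT_comp (measurable_coord i) measurable_fst).
have m2 (i : 'I_d) : measurable_fun setT (fun z : Z => z.2 ord0 i).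
  exact: (measurableT_comp (measurable_coord i) measurable_snd).
have mr (x : Z -> R) b : measurable_fun setT x -> measurable [set z | b < x z].
  move=> mx; rewrite (_ : [set z | _] = setT `&` x @^-1` `]b, +oo[%classic).
    exact: mx.
  by rewrite setTI; apply/seteqP; split => t /=; rewrite in_itv/= andbT.
suff H : measurable `<=` multiplier_sets muZ B B' trig by move=> /H[].
apply: sigma_algebra_prod_rV => // i b; split.
- exact: mr (m1 i).
- apply: multiplier_ray => // a.
  (* The symplectic form pairs [zeta.2] with [z.1], and [zeta.1] with [z.2] up to sign; hence a
     witness in the opposite slot, negated in the second case. *)
  exists (0, \row_k (a / (2 * pi) *+ (k == i))) => z.
  by rewrite /sympl/= dot0l subr0 dot_delta mulrA [2 * pi * _]mulrC divfK.
- exact: mr (m2 i).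
- apply: multiplier_ray => // a.
  exists (- \row_k (a / (2 * pi) *+ (k == i)), 0) => z.
  by rewrite /sympl/= dot0l dotNl opprK add0r dot_delta mulrA [2 * pi * _]mulrC divfK.
Qed.

Lemma cvg_sympl (zeta_ : nat -> Z) (zeta z : Z) :
  (forall n, ball zeta n.+1%:R^-1 (zeta_ n)) ->
  (sympl (zeta_ n) z) @[n --> \oo] --> sympl zeta z.
Proof.
move=> hz.
have H (u : nat -> R) (a : R) : (forall n, `|a - u n| < n.+1%:R^-1) -> u @ \oo --> a.
  move=> h; apply/cvgrPdist_lt => e e0.
  have := @cvg_harmonic R => /cvgr_lt /(_ e e0); apply: filterS => n.
  exact: lt_trans (h n).
have hdot (x_ : nat -> 'rV[R]_d) x w : (forall n, ball x n.+1%:R^-1 (x_ n)) ->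
    (dot (x_ n) w) @[n --> \oo] --> dot x w.
  move=> hx; apply: cvgn_sum => i; apply: cvgM; last exact: cvg_cst.
  by apply: H => n; have [_] := hx n; apply.
by apply: cvgB; apply: hdot => n; have [] := hz n.
Qed.

Lemma trigonometric_uniqueness (D : set Z) : dense D ->
  (forall zeta, D zeta -> forall theta, int_diff muZ B B' (trig (zeta, theta)) = 0) ->
  muZ (B `+` B') = 0%E.
Proof.
move=> dD h0.
have {}h0 k : int_diff muZ B B' (trig k) = 0.
  case: k => zeta theta.
  have /choice[zeta_ hz] n : exists xi, D xi /\ ball zeta n.+1%:R^-1 xi.
    have n0 : 0 < n.+1%:R^-1 :> R by rewrite invr_gt0.
    have [|xi [xi1 xi2]] := dD _ _ (open_interior (ball zeta n.+1%:R^-1)).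
      by exists zeta; exact: nbhsx_ballx.
    by exists xi; split => //; exact: interior_subset xi1.
  apply: (@int_diff_lim0 _ _ _ _ _ _ mB mB' Boo Boo'
    (fun n => trig (zeta_ n, theta)) _ 1).
  - by move=> n; exact: bmeas_trig.
  - by move=> n z; rewrite ler_norml cos_geN1 cos_le1.
  - move=> z; apply: continuous_cvg; first exact: continuous_cos.
    apply: cvgD; last exact: cvg_cst.
    apply: cvgM; first exact: cvg_cst.
    by apply: cvg_sympl => n; have [] := hz n.
  - by move=> n; apply: h0; have [] := hz n.
have H A : measurable A -> muZ (B `&` A) = muZ (B' `&` A).
  (* By [h0] the constant 1 is annihilated, hence so is [\1_A]; testing it against [trig (0, 0) = 1]
     compares the masses of [A]. *)
  move=> mA; have [_ /(_ (cst 1)) []] := multiplier_measurable mA.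
    split; first exact: bmeas_cst.
    by move=> k; under [X in int_diff _ _ _ X]eq_fun do rewrite mul1r.
  move=> _ /(_ (0, 0)).
  under [X in int_diff _ _ _ X]eq_fun do
    rewrite /trig /sympl/= !dot0l subr0 mulr0 addr0 cos0 mulr1 mul1r.
  rewrite /int_diff /Rintegral !integral_indic//.
  rewrite ![A `&` _]setIC => /eqP; rewrite subr_eq0 => /eqP E.
  rewrite -[LHS]fineK; last first.
    rewrite ge0_fin_numE//; apply: le_lt_trans Boo; apply: le_measure => //;
      by rewrite inE//; exact: measurableI.
  rewrite E fineK// ge0_fin_numE//; apply: le_lt_trans Boo'; apply: le_measure => //;
      by rewrite inE//; exact: measurableI.
have mD1 := measurableD mB mB'; have mD2 := measurableD mB' mB.
(* For this difference as [A], the right-hand side of [H] is the measure of the empty set. *)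
have E1 : muZ (B `\` B') = 0%E.
  have := H _ mD1; rewrite setIDA setIid => ->.
  by rewrite setIDA setIC -setIDA setDv setI0 measure0.
have E2 : muZ (B' `\` B) = 0%E.
  have := H _ mD2; rewrite [in RHS]setIDA setIid => <-.
  by rewrite setIDA setIC -setIDA setDv setI0 measure0.
apply/eqP; rewrite eq_le measure_ge0 andbT.
apply: le_trans (measureU2 _ mD1 mD2) _.
by rewrite [X in (X + _)%E]E1 [X in (_ + X)%E]E2 adde0.
Qed.

End trigonometric_uniqueness.

(** * The space L^2(R^d) *)

Section complex_parts.
Variable R : realType.
Local Notation C := R[i].
Implicit Types z w : C.

(** The squared modulus as a real number: a polynomial in the two parts, free of square roots and
    within reach of [ring] and [lra]. *)
Definition nsq z : R := complex.Re z ^+ 2 + complex.Im z ^+ 2.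

Lemma complex_ext z w :
  complex.Re z = complex.Re w -> complex.Im z = complex.Im w -> z = w.
Proof. by case: z => a b; case: w => x y /= -> ->. Qed.

Lemma ReD z w : complex.Re (z + w) = complex.Re z + complex.Re w.
Proof. by case: z; case: w. Qed.

Lemma ImD z w : complex.Im (z + w) = complex.Im z + complex.Im w.
Proof. by case: z; case: w. Qed.

Lemma ReN z : complex.Re (- z) = - complex.Re z.
Proof. by case: z. Qed.

Lemma ImN z : complex.Im (- z) = - complex.Im z.
Proof. by case: z. Qed.

Lemma ReM z w :
  complex.Re (z * w) = complex.Re z * complex.Re w - complex.Im z * complex.Im w.
Proof. by case: z; case: w. Qed.

Lemma ImM z w :
  complex.Im (z * w) = complex.Re z * complex.Im w + complex.Im z * complex.Re w.
Proof. by case: z; case: w. Qed.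

Lemma ReJ z : complex.Re (z^*)%R = complex.Re z.
Proof. by case: z. Qed.

Lemma ImJ z : complex.Im (z^*)%R = - complex.Im z.
Proof. by case: z. Qed.

Lemma Re_sum I (r : seq I) (F : I -> C) :
  complex.Re (\sum_(i <- r) F i) = \sum_(i <- r) complex.Re (F i).
Proof. by apply: (big_morph _ ReD). Qed.

Lemma Im_sum I (r : seq I) (F : I -> C) :
  complex.Im (\sum_(i <- r) F i) = \sum_(i <- r) complex.Im (F i).
Proof. by apply: (big_morph _ ImD). Qed.

Definition ReImE := (ReD, ImD, ReN, ImN, ReM, ImM, ReJ, ImJ).

Lemma nsq_ge0 z : 0 <= nsq z.
Proof. by rewrite addr_ge0// sqr_ge0. Qed.

Lemma nsqM z w : nsq (z * w) = nsq z * nsq w.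
Proof. by rewrite /nsq !ReImE; ring. Qed.

Lemma nsqJ z : nsq (z^*)%R = nsq z.
Proof. by rewrite /nsq !ReImE; ring. Qed.

Lemma nsqN z : nsq (- z) = nsq z.
Proof. by rewrite /nsq !ReImE; ring. Qed.

Lemma nsqr (a : R) : nsq a%:C = a ^+ 2.
Proof. by rewrite /nsq/= expr0n addr0. Qed.

Lemma nsq_expi (a : R) : nsq (expi a) = 1.
Proof. exact: cos2Dsin2. Qed.

Lemma mulJ_nsq z : z * (z^*)%R = (nsq z)%:C.
Proof. apply: complex_ext; rewrite /nsq !ReImE/=; ring. Qed.

Lemma nsqD_le z w : nsq (z + w) <= 2 * (nsq z + nsq w).
Proof.
rewrite /nsq !ReImE; set a := complex.Re z; set b := complex.Im z.
set c := complex.Re w; set e := complex.Im w.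
by have := sqr_ge0 (a - c); have := sqr_ge0 (b - e); rewrite !expr2; lra.
Qed.

Lemma Re_sqr_le z : complex.Re z ^+ 2 <= nsq z.
Proof. by rewrite lerDl sqr_ge0. Qed.

Lemma Im_sqr_le z : complex.Im z ^+ 2 <= nsq z.
Proof. by rewrite lerDr sqr_ge0. Qed.

Lemma nsq_eq0 z : nsq z = 0 -> z = 0.
Proof.
move=> z0; apply: complex_ext => /=; apply/eqP; rewrite -sqrf_eq0 eq_le sqr_ge0 andbT.
  by rewrite -z0 Re_sqr_le.
by rewrite -z0 Im_sqr_le.
Qed.

Lemma expiD (a b : R) : expi (a + b) = expi a * expi b.
Proof. by apply: complex_ext; rewrite ReImE/= ?cosD ?sinD//; ring. Qed.

Lemma expi0 : expi (0 : R) = 1.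
Proof. by apply: complex_ext; rewrite /= ?cos0 ?sin0. Qed.

Lemma expiJ (a : R) : (expi a)^*%R = expi (- a).
Proof. by apply: complex_ext; rewrite ReImE/= ?cosN ?sinN. Qed.

Lemma cvg0_sqr (u : nat -> R) (v : nat -> R) :
  (forall n, u n ^+ 2 <= v n) -> v @ \oo --> 0 -> u @ \oo --> 0.
Proof.
move=> uv v0; apply/cvgr0Pnorm_lt => e e0.
have e20 : 0 < e ^+ 2 by rewrite exprn_gt0.
move: v0 => /cvgr_lt /(_ _ e20); apply: filterS => n vn.
rewrite -(ltr_pXn2r (n := 2))// ?nnegrE ?(ltW e0)//.
by rewrite real_normK ?num_real// (le_lt_trans (uv n)).
Qed.

Lemma Ccvg_nsq (u : nat -> C) l :
  nsq (u n - l) @[n --> \oo] --> 0 -> Ccvg u l.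
Proof.
move=> h; split; apply/subr_cvg0.
- apply: (cvg0_sqr _ h) => n; apply: le_trans (Re_sqr_le _).
  by rewrite !ReImE.
- apply: (cvg0_sqr _ h) => n; apply: le_trans (Im_sqr_le _).
  by rewrite !ReImE.
Qed.

Lemma Ccvg_unique (u : nat -> C) l l' : Ccvg u l -> Ccvg u l' -> l = l'.
Proof.
move=> [h1 h2] [h1' h2']; apply: complex_ext.
  exact: (cvg_unique (@Rhausdorff R) h1 h1').
exact: (cvg_unique (@Rhausdorff R) h2 h2').
Qed.

Lemma CcvgM (u v : nat -> C) l k :
  Ccvg u l -> Ccvg v k -> Ccvg (fun n => u n * v n) (l * k).
Proof.
move=> [u1 u2] [v1 v2]; split; rewrite ReImE.
  rewrite (_ : _ \o _ = fun n => complex.Re (u n) * complex.Re (v n) -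
    complex.Im (u n) * complex.Im (v n)); last by apply/funext => n; rewrite /= ReImE.
  by apply: cvgB; apply: cvgM.
rewrite (_ : _ \o _ = fun n => complex.Re (u n) * complex.Im (v n) +
  complex.Im (u n) * complex.Re (v n)); last by apply/funext => n; rewrite /= ReImE.
by apply: cvgD; apply: cvgM.
Qed.

Lemma Ccvg_cst (a : C) : Ccvg (fun=> a) a.
Proof. by split; exact: cvg_cst. Qed.

Lemma CcvgD (u v : nat -> C) l k :
  Ccvg u l -> Ccvg v k -> Ccvg (fun n => u n + v n) (l + k).
Proof.
move=> [u1 u2] [v1 v2]; split; rewrite ReImE.
  rewrite (_ : _ \o _ = fun n => complex.Re (u n) + complex.Re (v n));
    last by apply/funext => n; rewrite /= ReImE.
  exact: cvgD.
rewrite (_ : _ \o _ = fun n => complex.Im (u n) + complex.Im (v n));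
  last by apply/funext => n; rewrite /= ReImE.
exact: cvgD.
Qed.

Lemma Ccvg_sum I (r : seq I) (u : I -> nat -> C) (l : I -> C) :
  (forall i, Ccvg (u i) (l i)) ->
  Ccvg (fun n => \sum_(i <- r) u i n) (\sum_(i <- r) l i).
Proof.
move=> ul; elim: r => [|i r IH].
  by rewrite big_nil; under eq_fun do rewrite big_nil; exact: Ccvg_cst.
by rewrite big_cons; under eq_fun do rewrite big_cons; exact: CcvgD.
Qed.

End complex_parts.

Section square_integrable.
Variables (R : realType) (d : nat).
Local Notation C := R[i].
Local Notation Rd := 'rV[R]_d.
Local Notation mu := (lebesgue_rV R d).
Implicit Types (f g h : Rd -> C) (a : C).

Lemma L2normE f :
  L2norm f = ((\int[mu]_t (nsq (f t))%:E) `^ 2^-1)%E.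
Proof.
rewrite /L2norm unlock; congr (_ `^ _)%E; apply: eq_integral => t _.
case: (f t) => x y; rewrite /nsq /ComplexField.Normc.normc /=.
rewrite ger0_norm ?sqrtr_ge0// powR_mulrn ?sqrtr_ge0// sqr_sqrtr//.
by rewrite addr_ge0// sqr_ge0.
Qed.

Lemma measurable_nsq f : measurable_fun setT (@complex.Re R \o f) ->
  measurable_fun setT (@complex.Im R \o f) ->
  measurable_fun setT (fun t => nsq (f t)).
Proof. by move=> m1 m2; apply: measurable_funD; exact: measurable_funX. Qed.

Lemma L2P f : L2 f <-> [/\ measurable_fun setT (@complex.Re R \o f),
  measurable_fun setT (@complex.Im R \o f) &
  mu.-integrable setT (fun t => (nsq (f t))%:E)].
Proof.
suff E : measurable_fun setT (@complex.Re R \o f) ->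
  measurable_fun setT (@complex.Im R \o f) ->
  (L2norm f < +oo)%E <-> mu.-integrable setT (fun t => (nsq (f t))%:E).
  by split=> -[m1 m2 /(E m1 m2) h].
move=> m1 m2; have mn := measurable_nsq m1 m2; rewrite L2normE.
have I0 : (0 <= \int[mu]_t (nsq (f t))%:E)%E.
  by apply: integral_ge0 => t _; rewrite lee_fin nsq_ge0.
split=> [h|/integrableP[_ h]].
  apply/integrableP; split; first exact/measurable_EFinP.
  under eq_integral do rewrite gee0_abs ?lee_fin ?nsq_ge0//.
  by apply: lty_poweRy h; rewrite invr_eq0 pnatr_eq0.
apply: poweR_lty; under eq_integral do rewrite -[(_)%:E]gee0_abs ?lee_fin ?nsq_ge0//.
exact: h.
Qed.

End square_integrable.

(** * The inner product and the Cauchy-Schwarz inequality *)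

Section inner_product.
Variables (R : realType) (d : nat).
Local Notation C := R[i].
Local Notation Re := (@complex.Re R).
Local Notation Im := (@complex.Im R).
Local Notation Rd := 'rV[R]_d.
Local Notation mu := (lebesgue_rV R d).
Implicit Types (f g h : Rd -> C) (a : C).

Definition cintegrable (F : Rd -> C) :=
  mu.-integrable setT (EFin \o (Re \o F)) /\ mu.-integrable setT (EFin \o (Im \o F)).

Lemma integrableZr (a : R) (u : Rd -> R) : mu.-integrable setT (EFin \o u) ->
  mu.-integrable setT (fun t => (a * u t)%:E).
Proof. by move=> iu; under eq_fun do rewrite EFinM; exact: integrableZl. Qed.

Lemma CintegralD (F G : Rd -> C) : cintegrable F -> cintegrable G ->
  Cintegral mu setT (fun t => F t + G t) = Cintegral mu setT F + Cintegral mu setT G.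
Proof.
move=> [F1 F2] [G1 G2]; apply: complex_ext; rewrite ReImE/=.
  by under eq_Rintegral do rewrite ReD; rewrite RintegralD.
by under eq_Rintegral do rewrite ImD; rewrite RintegralD.
Qed.

Lemma CintegralZ a (F : Rd -> C) : cintegrable F ->
  Cintegral mu setT (fun t => a * F t) = a * Cintegral mu setT F.
Proof.
move=> [F1 F2]; apply: complex_ext; rewrite ReImE/=.
  under eq_Rintegral do rewrite ReM.
  by rewrite RintegralB ?RintegralZl//; exact: integrableZr.
under eq_Rintegral do rewrite ImM.
by rewrite RintegralD ?RintegralZl//; exact: integrableZr.
Qed.

Lemma CintegralJ (F : Rd -> C) : cintegrable F ->
  Cintegral mu setT (fun t => (F t)^*%R) = (Cintegral mu setT F)^*%R.
Proof.
move=> [F1 F2]; apply: complex_ext; rewrite ReImE/=.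
  by under eq_Rintegral do rewrite ReJ.
under eq_Rintegral do rewrite ImJ -mulN1r.
by rewrite RintegralZl// mulN1r.
Qed.

Lemma L2_mRe f : L2 f -> measurable_fun setT (Re \o f).
Proof. by case. Qed.

Lemma L2_mIm f : L2 f -> measurable_fun setT (Im \o f).
Proof. by case. Qed.

Lemma L2_nsq f : L2 f -> mu.-integrable setT (fun t => (nsq (f t))%:E).
Proof. by move=> /L2P[]. Qed.

Lemma L2_dominated f (u : Rd -> R) :
  measurable_fun setT (Re \o f) -> measurable_fun setT (Im \o f) ->
  mu.-integrable setT (EFin \o u) -> (forall t, nsq (f t) <= u t) -> L2 f.
Proof.
move=> m1 m2 iu fu; apply/L2P; split => //.
apply: le_integrable iu => //; first by apply/measurable_EFinP; exact: measurable_nsq.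
move=> t _ /=; rewrite lee_fin !ger0_norm ?nsq_ge0//.
by rewrite (le_trans _ (fu t))// nsq_ge0.
Qed.

Lemma L2D f g : L2 f -> L2 g -> L2 (fun t => f t + g t).
Proof.
move=> Lf Lg.
apply: (@L2_dominated _ (fun t => 2 * (nsq (f t) + nsq (g t)))).
- rewrite (_ : _ \o _ = fun t => Re (f t) + Re (g t)).
    by apply: measurable_funD; [exact: L2_mRe Lf|exact: L2_mRe Lg].
  by apply/funext => t /=; rewrite ReD.
- rewrite (_ : _ \o _ = fun t => Im (f t) + Im (g t)).
    by apply: measurable_funD; [exact: L2_mIm Lf|exact: L2_mIm Lg].
  by apply/funext => t /=; rewrite ImD.
- apply: integrableZr; rewrite (_ : EFin \o _ = fun t => ((nsq (f t))%:E + (nsq (g t))%:E)%E)//.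
  by apply: integrableD => //; exact: L2_nsq.
- by move=> t; exact: nsqD_le.
Qed.

Lemma measurable_cmul disp (T : measurableType disp) (u v : T -> C) :
  measurable_fun setT (Re \o u) -> measurable_fun setT (Im \o u) ->
  measurable_fun setT (Re \o v) -> measurable_fun setT (Im \o v) ->
  measurable_fun setT (Re \o (fun t => u t * v t)) /\
  measurable_fun setT (Im \o (fun t => u t * v t)).
Proof.
move=> u1 u2 v1 v2; split.
  rewrite (_ : _ \o _ = fun t => Re (u t) * Re (v t) - Im (u t) * Im (v t)).
    by apply: measurable_funB; apply: measurable_funM;
      [exact: u1|exact: v1|exact: u2|exact: v2].
  by apply/funext => t /=; rewrite ReM.
rewrite (_ : _ \o _ = fun t => Re (u t) * Im (v t) + Im (u t) * Re (v t)).
  by apply: measurable_funD; apply: measurable_funM;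
    [exact: u1|exact: v2|exact: u2|exact: v1].
by apply/funext => t /=; rewrite ImM.
Qed.

Lemma L2M (u : Rd -> C) f (M : R) :
  measurable_fun setT (Re \o u) -> measurable_fun setT (Im \o u) ->
  (forall t, nsq (u t) <= M) -> L2 f -> L2 (fun t => u t * f t).
Proof.
move=> u1 u2 uM Lf.
have [m1 m2] := measurable_cmul u1 u2 (L2_mRe Lf) (L2_mIm Lf).
apply: (@L2_dominated _ (fun t => M * nsq (f t))) => //.
  by apply: integrableZr; exact: L2_nsq.
by move=> t; rewrite nsqM ler_wpM2r// nsq_ge0.
Qed.

Lemma L2Z a f : L2 f -> L2 (fun t => a * f t).
Proof. by apply: (@L2M (fun=> a) f (nsq a)) => //; exact: measurable_cst. Qed.

Lemma L2N f : L2 f -> L2 (fun t => - f t).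
Proof. by move=> /(L2Z (-1)); under eq_fun do rewrite mulN1r. Qed.

Lemma L2B f g : L2 f -> L2 g -> L2 (fun t => f t - g t).
Proof. by move=> Lf /L2N; exact: L2D. Qed.

Lemma L2_0 : L2 (fun _ : Rd => 0 : C).
Proof.
apply: (@L2_dominated _ (fun=> 0)) => //.
- exact: measurable_cst.
- exact: measurable_cst.
- exact: integrable0.
- by move=> t; rewrite /nsq/= expr0n addr0.
Qed.

Lemma L2_sum I (r : seq I) (F : I -> Rd -> C) : (forall i, L2 (F i)) ->
  L2 (fun t => \sum_(i <- r) F i t).
Proof.
move=> LF; elim: r => [|i r IH].
  by under eq_fun do rewrite big_nil; exact: L2_0.
by under eq_fun do rewrite big_cons; exact: L2D.
Qed.

Lemma L2_cintegrable f g : L2 f -> L2 g -> cintegrable (fun t => f t * (g t)^*%R).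
Proof.
move=> Lf Lg.
have iu : mu.-integrable setT (EFin \o (fun t => nsq (f t) + nsq (g t))).
  rewrite (_ : EFin \o _ = fun t => ((nsq (f t))%:E + (nsq (g t))%:E)%E)//.
  by apply: integrableD => //; exact: L2_nsq.
have [||m1 m2] := @measurable_cmul _ _ f (fun t => (g t)^*%R) (L2_mRe Lf) (L2_mIm Lf).
- rewrite (_ : _ \o _ = Re \o g); first exact: L2_mRe.
  by apply/funext => t /=; rewrite ReJ.
- rewrite (_ : _ \o _ = fun t => - Im (g t)).
    by apply: measurableT_comp => //; exact: L2_mIm Lg.
  by apply/funext => t /=; rewrite ImJ.
have H (x y z w : R) : `|x * y + z * w| <= x ^+ 2 + z ^+ 2 + (y ^+ 2 + w ^+ 2).
  have := sqr_ge0 (x - y); have := sqr_ge0 (x + y).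
  have := sqr_ge0 (z - w); have := sqr_ge0 (z + w).
  by rewrite ler_norml !expr2 => *; apply/andP; split; lra.
split; apply: le_integrable iu => //; do ?exact/measurable_EFinP;
  move=> t _; rewrite /= lee_fin !ReImE [leRHS]ger0_norm ?(addr_ge0 (nsq_ge0 _) (nsq_ge0 _))//.
  by rewrite mulrN opprK; exact: H.
rewrite mulrN addrC /nsq [Re (g t) ^+ 2 + _]addrC.
have := H (Im (f t)) (Re (g t)) (- Re (f t)) (Im (g t)).
by rewrite mulNr sqrrN; lra.
Qed.

Lemma innerDl f g h : L2 f -> L2 g -> L2 h ->
  inner (fun t => f t + g t) h = inner f h + inner g h.
Proof.
move=> Lf Lg Lh; rewrite /inner; under [X in Cintegral _ _ X]eq_fun do rewrite mulrDl.
by rewrite CintegralD//; exact: L2_cintegrable.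
Qed.

Lemma innerZl a f h : L2 f -> L2 h ->
  inner (fun t => a * f t) h = a * inner f h.
Proof.
move=> Lf Lh; rewrite /inner; under [X in Cintegral _ _ X]eq_fun do rewrite -mulrA.
by rewrite CintegralZ//; exact: L2_cintegrable.
Qed.

Lemma innerC f g : L2 f -> L2 g -> inner g f = (inner f g)^*%R.
Proof.
move=> Lf Lg; rewrite /inner -CintegralJ; last exact: L2_cintegrable.
by congr Cintegral; apply/funext => t; rewrite rmorphM/= conjCK mulrC.
Qed.

Lemma innerDr f g h : L2 f -> L2 g -> L2 h ->
  inner h (fun t => f t + g t) = inner h f + inner h g.
Proof.
move=> Lf Lg Lh; rewrite innerC ?innerDl//; last exact: L2D.
by rewrite rmorphD/= -!innerC.
Qed.

Lemma innerZr a f h : L2 f -> L2 h ->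
  inner h (fun t => a * f t) = (a^*)%R * inner h f.
Proof.
move=> Lf Lh; rewrite innerC ?innerZl//; last exact: L2Z.
by rewrite rmorphM/= -innerC.
Qed.

Lemma innerNl f h : L2 f -> L2 h -> inner (fun t => - f t) h = - inner f h.
Proof.
by move=> Lf Lh; under [X in inner X _]eq_fun do rewrite -mulN1r; rewrite innerZl// mulN1r.
Qed.

Lemma innerBl f g h : L2 f -> L2 g -> L2 h ->
  inner (fun t => f t - g t) h = inner f h - inner g h.
Proof. by move=> Lf Lg Lh; rewrite innerDl ?innerNl//; exact: L2N. Qed.

Lemma inner0l h : L2 h -> inner (fun _ : Rd => 0) h = 0.
Proof.
move=> Lh; rewrite -[RHS](mul0r (inner (fun=> 0) h)) -innerZl//; last exact: L2_0.
by congr inner; apply/funext => t; rewrite mul0r.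
Qed.

Lemma inner_suml I (r : seq I) (F : I -> Rd -> C) h :
  (forall i, L2 (F i)) -> L2 h ->
  inner (fun t => \sum_(i <- r) F i t) h = \sum_(i <- r) inner (F i) h.
Proof.
move=> LF Lh; elim: r => [|i r IH].
  by rewrite big_nil; under [X in inner X _]eq_fun do rewrite big_nil; exact: inner0l.
rewrite big_cons; under [X in inner X _]eq_fun do rewrite big_cons.
by rewrite innerDl ?IH//; exact: L2_sum.
Qed.

(** On [L2] this is the square of the extended real number [L2norm f], available as a real
    number. *)
Definition sqnorm f : R := Re (inner f f).

Lemma sqnormE f : sqnorm f = (\int[mu]_t nsq (f t))%R.
Proof. by apply: eq_Rintegral => t _; rewrite mulJ_nsq. Qed.

Lemma sqnorm_ge0 f : 0 <= sqnorm f.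
Proof. by rewrite sqnormE; apply: Rintegral_ge0 => t _; exact: nsq_ge0. Qed.

Lemma sqnormZ a f : L2 f -> sqnorm (fun t => a * f t) = nsq a * sqnorm f.
Proof.
move=> Lf; rewrite /sqnorm innerZl ?innerZr//; last exact: L2Z.
by rewrite mulrA mulJ_nsq ReM/= mul0r subr0.
Qed.

Lemma sqnormB f g : L2 f -> L2 g ->
  sqnorm (fun t => f t - g t) = sqnorm f - 2 * Re (inner f g) + sqnorm g.
Proof.
move=> Lf Lg; rewrite /sqnorm innerBl//; last exact: L2B.
have LNg := L2N Lg.
rewrite [inner f _]innerDr// [inner g (fun t => _ - _)]innerDr//.
rewrite [inner f (fun t => - _)]innerC// [inner g (fun t => - _)]innerC//.
rewrite !innerNl// (innerC Lf Lg) !ReImE; ring.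
Qed.

Lemma cauchy_schwarz f g : L2 f -> L2 g ->
  nsq (inner f g) <= sqnorm f * sqnorm g.
Proof.
move=> Lf Lg; have Lag a := L2Z a Lg.
(* This expands the squared norm of [f - r <f, g> g]. Aligning the coefficient with [<f, g>] makes
   the cross term real, so a real parameter [r] is enough. *)
have key (r : R) : 0 <= sqnorm f - 2 * (r * nsq (inner f g)) +
    r ^+ 2 * nsq (inner f g) * sqnorm g.
  have := sqnorm_ge0 (fun t => f t - (r%:C * inner f g) * g t).
  rewrite sqnormB// sqnormZ// innerZr// nsqM nsqr.
  move: (inner f g) => w.
  by have -> : Re ((r%:C * w)^*%R * w) = r * nsq w by rewrite /nsq !ReImE/=; ring.
have := sqnorm_ge0 g; rewrite le_eqVlt => /predU1P[g0|g0].
  rewrite -g0 mulr0; move: key; rewrite -g0; set x := nsq _ => key.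
  rewrite leNgt; apply/negP => x0.
  (* When [sqnorm g = 0] the bound is affine in [r], and this [r] gives it the value -1. *)
  have := key ((sqnorm f + 1) / (2 * x)).
  rewrite mulr0 addr0 (_ : 2 * _ = sqnorm f + 1); last by field; lra.
  lra.
(* This [r] minimizes the quadratic polynomial in [key]. *)
have := key (sqnorm g)^-1; set x := nsq _; rewrite (_ : _ - _ + _ = sqnorm f - x / sqnorm g).
  by rewrite subr_ge0 ler_pdivrMr.
by field; rewrite gt_eqF.
Qed.

Lemma L2normE_sqnorm f : L2 f -> L2norm f = (Num.sqrt (sqnorm f))%:E.
Proof.
move=> Lf; rewrite L2normE sqnormE.
have := integrable_fin_num measurableT (L2_nsq Lf).
rewrite /Rintegral; have : (0 <= \int[mu]_t (nsq (f t))%:E)%E.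
  by apply: integral_ge0 => t _; rewrite lee_fin nsq_ge0.
case: (integral _ _ _) => //= r r0 _; rewrite lee_fin in r0.
by rewrite powR12_sqrt.
Qed.

Lemma L2cvg_sqnorm (u : nat -> Rd -> C) f :
  (forall n, L2 (u n)) -> L2 f -> L2cvg u f ->
  sqnorm (fun t => u n t - f t) @[n --> \oo] --> 0.
Proof.
move=> Lu Lf; have LB n := L2B (Lu n) Lf.
rewrite /L2cvg (_ : (fun N => _) = fun n => (Num.sqrt (sqnorm (fun t => u n t - f t)))%:E).
  move=> /fine_cvg/= h.
  rewrite (_ : (fun n => _) = fun n => Num.sqrt (sqnorm (fun t => u n t - f t)) *
    Num.sqrt (sqnorm (fun t => u n t - f t))).
    rewrite -[X in _ --> X](mulr0 0); exact: cvgM.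
  by apply/funext => n; rewrite -expr2 sqr_sqrtr ?sqnorm_ge0.
by apply/funext => n; rewrite -L2normE_sqnorm.
Qed.

Lemma inner_cvgl (u : nat -> Rd -> C) f g :
  (forall n, L2 (u n)) -> L2 f -> L2 g ->
  sqnorm (fun t => u n t - f t) @[n --> \oo] --> 0 ->
  Ccvg (fun n => inner (u n) g) (inner f g).
Proof.
move=> Lu Lf Lg u0; apply: Ccvg_nsq.
apply: (@squeeze_cvgr _ _ _ _ (cst 0)
  (fun n => sqnorm (fun t => u n t - f t) * sqnorm g)).
- apply: nearW => n; rewrite nsq_ge0/= -innerBl//.
  by apply: cauchy_schwarz => //; exact: L2B.
- exact: cvg_cst.
- rewrite -[X in _ --> X](mul0r (sqnorm g)); apply: cvgM => //; exact: cvg_cst.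
Qed.

End inner_product.

(** * Time-frequency shifts *)

Section translation.
Variable R : realType.

Lemma lebesgue_measure_translate (a : R) (A : set (measurableTypeR R)) :
  measurable A ->
  lebesgue_measure ((fun x : measurableTypeR R => x + a) @^-1` A) = lebesgue_measure A.
Proof.
move=> mA; have mf : measurable_fun setT (fun x : measurableTypeR R => (x + a : measurableTypeR R)).
  exact: (@measurable_funD _ _ _ _ (fun x : measurableTypeR R => x) (cst a)).
pose f (x : measurableTypeR R) : measurableTypeR R := x + a.
have := @lebesgue_measure_unique R (pushforward lebesgue_measure f).
move=> /(_ mf _ A mA)/esym; apply => _ [[u v]] _ <- /=.
rewrite /pushforward (_ : _ @^-1` _ = `](u - a), (v - a)]%classic).
  by rewrite /= !lebesgue_measure_itv/= !lte_fin ltrD2r !EFinB; case: ifP => // _;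
    rewrite -!EFinB; congr EFin; ring.
by apply/seteqP; split => x /=; rewrite !in_itv/= ltrBlDr lerBrDr.
Qed.

Lemma measurable_translate n (a : 'rV[R]_n) :
  measurable_fun setT (fun x : 'rV[R]_n => x + a).
Proof.
apply: measurable_fun_rV => i; under eq_fun do rewrite mxE.
by apply: measurable_funD => //; exact: measurable_coord.
Qed.

(** By induction on the dimension: a translation acts separately on the first coordinate and on the
    others, so the translated measure agrees with the product measure on rectangles, which determine
    it. In dimension 0 there is only one point. *)
Lemma lebesgue_rV_translate n (a : 'rV[R]_n) (A : set 'rV[R]_n) : measurable A ->
  lebesgue_rV R n ((fun x => x + a) @^-1` A) = lebesgue_rV R n A.
Proof.
elim: n => [|n IHn] in a A *.
  move=> _; congr (_ _); apply/seteqP; split => x /=;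
    by rewrite (_ : x + a = x)//; apply/rowP => -[].
move=> mA.
pose a' := \row_(j < n) a ord0 (lift ord0 j).
pose tau (p : measurableTypeR R * 'rV[R]_n) : measurableTypeR R * 'rV[R]_n :=
  (p.1 + a ord0 ord0, p.2 + a').
have mtau : measurable_fun setT tau.
  apply: measurable_fun_pair.
    by apply: measurable_funD; [exact: measurable_fst|exact: measurable_cst].
  exact: (measurableT_comp (measurable_translate _)).
have mX : measurable (@cons_rV R n @^-1` A).
  by rewrite -[X in measurable X]setTI; exact: measurable_cons_rV.
have := @product_measure_unique _ _ _ _ _ lebesgue_measure (lebesgue_rV R n)
  (pushforward (lebesgue_measure \x lebesgue_rV R n)%E tau).
move=> /(_ mtau _ _ mX) /=; rewrite /lebesgue_cons /pushforward => ->.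
  congr (_ _); apply/seteqP; split => p /=;
    rewrite (_ : cons_rV p + a = cons_rV (tau p))//; apply/rowP => i;
    rewrite !mxE; case: unliftP => [j|] ->//=; by rewrite !mxE.
move=> B C mB mC.
rewrite (_ : tau @^-1` (B `*` C) = ((fun x : measurableTypeR R => x + a ord0 ord0) @^-1` B) `*`
  ((fun x => x + a') @^-1` C))//.
rewrite product_measure1E; first by congr (_ * _)%E; [exact: lebesgue_measure_translate|exact: IHn].
- rewrite -[X in measurable X]setTI.
  by apply: (@measurable_funD _ _ _ _ (fun x : measurableTypeR R => x) (cst _)).
- by rewrite -[X in measurable X]setTI; exact: measurable_translate.
Qed.

Lemma ge0_integral_translate n (a : 'rV[R]_n) (g : 'rV[R]_n -> \bar R) :
  measurable_fun setT g -> (forall x, 0 <= g x)%E ->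
  (\int[lebesgue_rV R n]_x g (x + a)%R = \int[lebesgue_rV R n]_x g x)%E.
Proof.
move=> mg g0.
rewrite -[LHS](@ge0_integral_pushforward _ _ _ _ _ (fun x : 'rV[R]_n => x + a)
  (@measurable_translate n a) (lebesgue_rV R n) setT g)//.
apply: eq_measure_integral; first exact: measurable_translate.
by move=> mt A mA _; exact: lebesgue_rV_translate.
Qed.

Lemma Rintegral_translate n (a : 'rV[R]_n) (f : 'rV[R]_n -> R) :
  measurable_fun setT f ->
  (\int[lebesgue_rV R n]_x f (x + a)%R)%R = (\int[lebesgue_rV R n]_x f x)%R.
Proof.
move=> mf; rewrite /Rintegral; congr fine.
rewrite integralE [RHS]integralE; congr (_ - _)%E.
- under eq_integral do rewrite funeposE.
  rewrite (ge0_integral_translate a (g := fun x => maxe (f x)%:E 0%E)).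
  + by apply: eq_integral => x _; rewrite funeposE.
  + by apply: measurable_maxe => //; exact/measurable_EFinP.
  + by move=> x; rewrite le_max lexx orbT.
- under eq_integral do rewrite funenegE.
  rewrite (ge0_integral_translate a (g := fun x => maxe (- (f x)%:E)%E 0%E)).
  + by apply: eq_integral => x _; rewrite funenegE.
  + by apply: measurable_maxe => //; apply: measurableT_comp => //; exact/measurable_EFinP.
  + by move=> x; rewrite le_max lexx orbT.
Qed.

End translation.

(** * The operators [tfshift], their adjoints and their phases *)

Section time_frequency_shifts.
Variables (R : realType) (d : nat).
Local Notation C := R[i].
Local Notation Re := (@complex.Re R).
Local Notation Im := (@complex.Im R).
Local Notation Rd := 'rV[R]_d.
Local Notation Z := (Rd * Rd)%type.
Local Notation mu := (lebesgue_rV R d).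
Local Notation muZ := (mu \x mu)%E.
Implicit Types (f g h : Rd -> C) (a : C) (z zeta : Z).

Lemma measurable_expi disp (T : measurableType disp) (u : T -> R) :
  measurable_fun setT u ->
  measurable_fun setT (Re \o (fun t => expi (u t))) /\
  measurable_fun setT (Im \o (fun t => expi (u t))).
Proof.
move=> mu'; split.
  exact: (measurableT_comp (continuous_measurable_fun (@continuous_cos R)) mu').
exact: (measurableT_comp (continuous_measurable_fun (@continuous_sin R)) mu').
Qed.

Lemma L2_translate (x : Rd) f : L2 f -> L2 (fun t => f (t + x)).
Proof.
move=> Lf; have [m1 m2 /integrableP[mn fin]] := (L2P f).1 Lf.
apply/L2P; split.
- exact: (measurableT_comp m1 (measurable_translate x)).
- exact: (measurableT_comp m2 (measurable_translate x)).
apply/integrableP; split.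
  exact: (measurableT_comp mn (measurable_translate x)).
rewrite (ge0_integral_translate x (g := fun t => `|(nsq (f t))%:E|%E))//.
exact: measurableT_comp.
Qed.

Lemma L2_expi (u : Rd -> R) f : measurable_fun setT u -> L2 f ->
  L2 (fun t => expi (u t) * f t).
Proof.
move=> mu' Lf; have [m1 m2] := measurable_expi mu'.
by apply: (@L2M _ _ (fun t => expi (u t)) f 1) => // t; rewrite nsq_expi.
Qed.

Lemma measurable_phase (w : Rd) : measurable_fun setT (fun t : Rd => 2 * pi * dot w t).
Proof. by apply: measurable_funM => //; exact: measurable_dot. Qed.

Lemma L2_tfshift z f : L2 f -> L2 (tfshift z f).
Proof.
move=> Lf; apply: L2_expi; first exact: measurable_phase.
exact: L2_translate.
Qed.

Lemma L2_tfshift_adj z f : L2 f -> L2 (tfshift_adj z f).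
Proof.
move=> Lf; apply: L2_expi; last exact: L2_translate.
apply: measurableT_comp => //.
exact: (measurableT_comp (measurable_phase z.2) (measurable_translate z.1)).
Qed.

Lemma inner_tfshiftl z f g : L2 f -> L2 g ->
  inner (tfshift z f) g = inner f (tfshift_adj z g).
Proof.
move=> Lf Lg.
have Cint (F : Rd -> C) (x : Rd) : cintegrable F ->
    Cintegral mu setT (fun t => F (t + x)) = Cintegral mu setT F.
  move=> [/measurable_int/measurable_EFinP m1 /measurable_int/measurable_EFinP m2].
  by congr (_ +i* _); [exact: (Rintegral_translate x m1)|exact: (Rintegral_translate x m2)].
rewrite /inner -(Cint _ z.1); last by apply: L2_cintegrable => //; exact: L2_tfshift.
congr Cintegral; apply/funext => t; rewrite /tfshift /tfshift_adj addrK.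
by rewrite rmorphM/= expiJ opprK mulrCA mulrA.
Qed.

Lemma inner_tfshift_adjl z f g : L2 f -> L2 g ->
  inner (tfshift_adj z f) g = inner f (tfshift z g).
Proof.
move=> Lf Lg; rewrite innerC//; last exact: L2_tfshift_adj.
by rewrite -inner_tfshiftl// -innerC//; exact: L2_tfshift.
Qed.

Lemma tfshiftK z f : tfshift_adj z (tfshift z f) = f.
Proof.
apply/funext => t; rewrite /tfshift /tfshift_adj addrK mulrA -expiD.
by rewrite addNr expi0 mul1r.
Qed.

Lemma inner_tfshift z f g : L2 f -> L2 g ->
  inner (tfshift z f) (tfshift z g) = inner f g.
Proof.
by move=> Lf Lg; rewrite inner_tfshiftl ?tfshiftK//; exact: L2_tfshift.
Qed.

Lemma sqnorm_tfshift z f : L2 f -> sqnorm (tfshift z f) = sqnorm f.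
Proof. by move=> Lf; rewrite /sqnorm inner_tfshift. Qed.

Lemma tfshift0 f : tfshift 0 f = f.
Proof.
by apply/funext => t; rewrite /tfshift/= dot0l mulr0 expi0 mul1r subr0.
Qed.

Lemma tfshift_adj0 f : tfshift_adj 0 f = f.
Proof.
by apply/funext => t; rewrite /tfshift_adj/= dot0l mulr0 oppr0 expi0 mul1r addr0.
Qed.

Lemma alpha0 S : alpha 0 S = S :> ((Rd -> C) -> Rd -> C).
Proof. by apply/funext => f; rewrite /alpha tfshift0 tfshift_adj0. Qed.

Lemma tfshift_adjE z f :
  tfshift_adj z f = fun t => expi (- (2 * pi * dot z.2 z.1)) * tfshift (- z) f t.
Proof.
apply/funext => t; rewrite /tfshift /tfshift_adj/= opprK mulrA -expiD.
congr (expi _ * _); rewrite dotNl (dotC z.2 (t + z.1)) dotDl (dotC t) (dotC z.1); ring.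
Qed.

Lemma tfshift_commute zeta z f :
  tfshift (- zeta) (tfshift z f) =
  fun t => expi (- (2 * pi * sympl zeta z)) * tfshift z (tfshift (- zeta) f) t.
Proof.
apply/funext => t; rewrite /tfshift/= !mulrA -!expiD opprK addrAC; congr (expi _ * f _).
  rewrite /sympl !dotNl ![dot z.2 _]dotC ![dot zeta.2 _]dotC [dot zeta.1 z.2]dotC.
  rewrite !dotDl !dotNl (dotC z.2 zeta.1); ring.
Qed.

(** Tonelli's theorem gives the measurability in [x] of the integrals of the positive and the
    negative part of [G]; subtraction and [fine] preserve it. *)
Lemma measurable_Rintegral_param disp (X : measurableType disp) (G : X * Rd -> R) :
  measurable_fun setT G ->
  measurable_fun setT (fun x => (\int[mu]_t G (x, t))%R).
Proof.
move=> mG; apply: (measurableT_comp (fine_measurable measurableT)).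
have mG' := (measurable_EFinP setT G).2 mG.
rewrite (_ : (fun x => _) = fun x => (fubini_F mu (EFin \o G)^\+ x - fubini_F mu (EFin \o G)^\- x)%E).
  apply: emeasurable_funB; apply: measurable_fun_fubini_tonelli_F => //.
    exact: measurable_funepos.
  exact: measurable_funeneg.
apply/funext => x; rewrite integralE /fubini_F; congr (_ - _)%E.
  by apply: eq_integral => t _; rewrite !funeposE.
by apply: eq_integral => t _; rewrite !funenegE.
Qed.

(** The short-time Fourier transform is an integral with parameter [z], and its kernel [K] is
    jointly measurable in [z] and [t]. *)
Lemma measurable_STFT f g : L2 f -> L2 g ->
  measurable_fun setT (Re \o STFT g f) /\ measurable_fun setT (Im \o STFT g f).
Proof.
move=> Lf Lg; pose K (p : Z * Rd) : C := f p.2 * (tfshift p.1 g p.2)^*%R.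
suff [K1 K2] : measurable_fun setT (Re \o K) /\ measurable_fun setT (Im \o K).
  by split; [exact: measurable_Rintegral_param K1|exact: measurable_Rintegral_param K2].
have mt : measurable_fun setT (fun p : Z * Rd => p.2) by exact: measurable_snd.
have mdot : measurable_fun setT (fun p : Z * Rd => dot p.1.2 p.2).
  apply: measurable_sum => i; apply: measurable_funM.
    apply: (measurableT_comp (measurable_coord i)).
    exact: (measurableT_comp measurable_snd measurable_fst).
  exact: (measurableT_comp (measurable_coord i)).
have msub : measurable_fun setT (fun p : Z * Rd => p.2 - p.1.1).
  apply: measurable_fun_rV => i; under eq_fun do rewrite !mxE.
  apply: measurable_funB.
    exact: (measurableT_comp (measurable_coord i)).
  apply: (measurableT_comp (measurable_coord i)).
  exact: (measurableT_comp measurable_fst measurable_fst).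
rewrite (_ : K = fun p => f p.2 * (expi (- (2 * pi * dot p.1.2 p.2)) * (g (p.2 - p.1.1))^*%R)).
  have [e1 e2] := @measurable_expi _ _ (fun p : Z * Rd => - (2 * pi * dot p.1.2 p.2))
    (measurableT_comp (@oppr_measurable R setT) (measurable_funM (measurable_cst _) mdot)).
  have g1 : measurable_fun setT (Re \o (fun p : Z * Rd => (g (p.2 - p.1.1))^*%R)).
    rewrite (_ : _ \o _ = Re \o g \o (fun p : Z * Rd => p.2 - p.1.1)).
      exact: (measurableT_comp (L2_mRe Lg)).
    by apply/funext => p /=; rewrite ReJ.
  have g2 : measurable_fun setT (Im \o (fun p : Z * Rd => (g (p.2 - p.1.1))^*%R)).
    rewrite (_ : _ \o _ = (fun t => - t) \o (Im \o g \o (fun p : Z * Rd => p.2 - p.1.1))).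
      exact: (measurableT_comp (@oppr_measurable R setT) (measurableT_comp (L2_mIm Lg) msub)).
    by apply/funext => p /=; rewrite ImJ.
  have [h1 h2] := measurable_cmul e1 e2 g1 g2.
  exact: (measurable_cmul (measurableT_comp (L2_mRe Lf) mt)
    (measurableT_comp (L2_mIm Lf) mt) h1 h2).
by apply/funext => p; rewrite /K /tfshift rmorphM/= expiJ.
Qed.

End time_frequency_shifts.

(** * The Fourier-Wigner transform of a convolution *)

Section tannery.
Variable R : realType.

(** Dominated convergence for series: the tails are bounded by those of [w] uniformly in [N], so up
    to a small error only finitely many terms matter. The last conclusion, uniform in [N], later
    serves as the bound for dominated convergence over phase space. *)
Lemma tannery (a : nat -> nat -> R) (w l h : nat -> R) :
  (forall N k, `|a N k| <= w k) -> cvgn (series w) ->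
  (forall k, a ^~ k @ \oo --> l k) ->
  (forall N, series (a N) @ \oo --> h N) ->
  [/\ cvgn (series l), h @ \oo --> limn (series l) &
      forall N, `|h N| <= limn (series w)].
Proof.
move=> aw cw al sa.
have w0 k : 0 <= w k by exact: le_trans (aw 0%N k).
have lw k : `|l k| <= w k.
  by apply: (@cvgn_le_ubound _ (fun N => `|a N k|)) => //; exact: cvg_norm.
have cl : cvgn (series l).
  apply: normed_cvg; apply: (@series_le_cvg _ (fun k => `|l k|) w) => //.
have wlim n : series w n <= limn (series w).
  apply: nondecreasing_cvgn_le => //; apply/nondecreasing_seqP => m.
  by rewrite /series/= big_nat_recr//= lerDl.
have tail (u : nat -> R) (s : R) (K : nat) : (forall k, `|u k| <= w k) ->
    series u @ \oo --> s -> `|s - series u K| <= limn (series w) - series w K.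
  move=> uw us.
  have /cvg_norm us' : (fun n => series u n - series u K) @ \oo --> s - series u K.
    by apply: cvgB => //; exact: cvg_cst.
  rewrite -(cvg_lim (@Rhausdorff R) us'); apply: limr_le.
    by apply/cvg_ex; exists (`|s - series u K|).
  exists K => // n /= Kn; rewrite sub_series_geq//.
  apply: (le_trans (ler_norm_sum _ _ _)).
  apply: (@le_trans _ _ (series w n - series w K)); last by rewrite lerB.
  rewrite sub_series_geq//; exact: ler_sum.
split=> //; last first.
  (* The tail from index 0 is the whole series. *)
  move=> N; have := tail _ _ 0%N (aw N) (sa N).
  by rewrite /series/= !big_geq// !subr0.
apply/cvgrPdist_lt => e e0; have e4 : 0 < e / 4 by rewrite divr_gt0.
have [K hK] : exists K, limn (series w) - series w K < e / 4.
  move/cvgrPdist_lt : cw => /(_ _ e4)[K _ /(_ K (leqnn K)) hK].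
  by exists K; rewrite (le_lt_trans _ hK)// ler_norm.
have : (fun N => series (a N) K) @ \oo --> series l K by exact: cvgn_sum.
move/cvgrPdist_lt => /(_ _ e4); apply: filterS => N hN.
have h1 := le_lt_trans (tail _ _ K lw cl) hK.
have h2 := le_lt_trans (tail _ _ K (aw N) (sa N)) hK.
move: h1 h2 hN; rewrite !ltr_norml => /andP[? ?] /andP[? ?] /andP[? ?].
apply/andP; split; lra.
Qed.

Lemma Ctannery (a : nat -> nat -> R[i]) (w : nat -> R) (l h : nat -> R[i]) :
  (forall N k, `|complex.Re (a N k)| <= w k /\ `|complex.Im (a N k)| <= w k) ->
  cvgn (series w) -> (forall k, Ccvg (a ^~ k) (l k)) ->
  (forall N, Ccvg (fun K => \sum_(k < K) a N k) (h N)) ->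
  exists2 L, Ccvg (fun K => \sum_(k < K) l k) L & Ccvg h L /\
    forall N, `|complex.Re (h N)| <= limn (series w) /\
              `|complex.Im (h N)| <= limn (series w).
Proof.
move=> aw cw al sa.
have ReE (u : nat -> R[i]) : @complex.Re R \o (fun K => \sum_(k < K) u k) =
    series (fun k => complex.Re (u k)).
  by apply/funext => K; rewrite /series/= Re_sum big_mkord.
have ImE (u : nat -> R[i]) : @complex.Im R \o (fun K => \sum_(k < K) u k) =
    series (fun k => complex.Im (u k)).
  by apply/funext => K; rewrite /series/= Im_sum big_mkord.
have [|||r1 r2 r3] := @tannery (fun N k => complex.Re (a N k)) w
    (fun k => complex.Re (l k)) (fun N => complex.Re (h N)) _ cw.
- by move=> N k; have [] := aw N k.
- by move=> k; have [] := al k.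
- by move=> N; rewrite -ReE; have [] := sa N.
have [|||i1 i2 i3] := @tannery (fun N k => complex.Im (a N k)) w
    (fun k => complex.Im (l k)) (fun N => complex.Im (h N)) _ cw.
- by move=> N k; have [] := aw N k.
- by move=> k; have [] := al k.
- by move=> N; rewrite -ImE; have [] := sa N.
exists (limn (series (fun k => complex.Re (l k))) +i*
  limn (series (fun k => complex.Im (l k)))).
  by split; rewrite ?ReE ?ImE.
by split.
Qed.

End tannery.

(** * Traces of nuclear operators along a resolution of the identity *)

Section trace_formula.
Variables (R : realType) (d : nat).
Local Notation C := R[i].
Local Notation Re := (@complex.Re R).
Local Notation Im := (@complex.Im R).
Local Notation Rd := 'rV[R]_d.
Local Notation Z := (Rd * Rd)%type.
Local Notation mu := (lebesgue_rV R d).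
Local Notation muZ := (mu \x mu)%E.
Implicit Types (f g : Rd -> C) (z zeta : Z).

(** A weak form of an orthonormal basis: finite families which may change entirely with [N], with
    Bessel's inequality at each [N] and Parseval's identity in the limit. It covers both the initial
    segments of an orthonormal basis and the atoms of growing algebras of sets. *)
Definition resolution (I : nat -> finType) (e : forall N, I N -> Rd -> C) : Prop :=
  [/\ forall N i, L2 (e N i),
      forall N f, L2 f -> \sum_i nsq (inner f (e N i)) <= sqnorm f
    & forall f g, L2 f -> L2 g ->
        Ccvg (fun N => \sum_i inner f (e N i) * inner (e N i) g) (inner f g)].

(* Unlike in [trace_class], no orthonormality is required, so that rank one
   operators are covered without normalization. *)
Definition nuclear (S : (Rd -> C) -> Rd -> C) (s : nat -> R)
    (xi eta : nat -> Rd -> C) : Prop :=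
  [/\ forall k, 0 <= s k, forall k, L2 (xi k) /\ L2 (eta k),
      cvgn (series (fun k => s k * (sqnorm (xi k) + sqnorm (eta k)))),
      forall f, L2 f -> L2 (S f)
    & forall f g, L2 f -> L2 g ->
        Ccvg (fun K => \sum_(k < K) (s k)%:C * (inner f (eta k) * inner (xi k) g))
          (inner (S f) g)].

Lemma normr_Re_mul (x y : C) : `|Re (x * y)| <= nsq x + nsq y.
Proof.
case: x => a b; case: y => c e /=; rewrite /nsq/= ler_norml.
have := sqr_ge0 (a - c); have := sqr_ge0 (a + c).
have := sqr_ge0 (b - e); have := sqr_ge0 (b + e).
have := sqr_ge0 a; have := sqr_ge0 b; have := sqr_ge0 c; have := sqr_ge0 e.
by rewrite !expr2 => *; apply/andP; split; lra.
Qed.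

Lemma normr_Im_mul (x y : C) : `|Im (x * y)| <= nsq x + nsq y.
Proof.
case: x => a b; case: y => c e /=; rewrite /nsq/= ler_norml.
have := sqr_ge0 (a - e); have := sqr_ge0 (a + e).
have := sqr_ge0 (b - c); have := sqr_ge0 (b + c).
have := sqr_ge0 a; have := sqr_ge0 b; have := sqr_ge0 c; have := sqr_ge0 e.
by rewrite !expr2 => *; apply/andP; split; lra.
Qed.

Lemma Re_Zreal (a : R) (z : C) : Re (a%:C * z) = a * Re z.
Proof. by rewrite ReM/= mul0r subr0. Qed.

Lemma Im_Zreal (a : R) (z : C) : Im (a%:C * z) = a * Im z.
Proof. by rewrite ImM/= mul0r addr0. Qed.

Lemma nsq_innerC f g : L2 f -> L2 g -> nsq (inner g f) = nsq (inner f g).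
Proof. by move=> Lf Lg; rewrite innerC// nsqJ. Qed.

Section nuclear_operator.
Variables (S : (Rd -> C) -> Rd -> C) (s : nat -> R) (xi eta : nat -> Rd -> C).
Hypothesis nS : nuclear S s xi eta.
Let w k := s k * (sqnorm (xi k) + sqnorm (eta k)).

Let s0 : forall k, 0 <= s k. Proof. by case: nS. Qed.
Let Lxi k : L2 (xi k). Proof. by case: nS => _ /(_ k)[]. Qed.
Let Leta k : L2 (eta k). Proof. by case: nS => _ /(_ k)[]. Qed.
Let cw : cvgn (series w). Proof. by case: nS. Qed.
Let LS f : L2 f -> L2 (S f). Proof. by case: nS => _ _ _ + _; apply. Qed.

Lemma nuclear_alpha z f g : L2 f -> L2 g ->
  Ccvg (fun K => \sum_(k < K) (s k)%:C *
      (inner f (tfshift z (eta k)) * inner (tfshift z (xi k)) g))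
    (inner (alpha z S f) g).
Proof.
move=> Lf Lg; rewrite /alpha inner_tfshiftl//; last by apply: LS; exact: L2_tfshift_adj.
have := (let: And5 _ _ _ _ h := nS in h) _ _ (L2_tfshift_adj z Lf) (L2_tfshift_adj z Lg).
congr (Ccvg _ _); apply/funext => K; apply: eq_bigr => k _.
by rewrite inner_tfshift_adjl// -inner_tfshiftl.
Qed.

(** The partial sums of the nuclear series are combinations of products of short-time Fourier
    transforms, hence measurable in [z]. Since shifts preserve norms, the Cauchy-Schwarz inequality
    bounds them uniformly in [z], and the pointwise limit inherits both properties. *)
Lemma bmeas_nuclear_alpha f g : L2 f -> L2 g ->
  bmeas (fun z => Re (inner (alpha z S f) g)) /\
  bmeas (fun z => Im (inner (alpha z S f) g)).
Proof.
move=> Lf Lg.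
pose T K z : C := \sum_(k < K) (s k)%:C * (STFT (eta k) f z * (STFT (xi k) g z)^*%R).
have TE K z : T K z = \sum_(k < K) (s k)%:C *
      (inner f (tfshift z (eta k)) * inner (tfshift z (xi k)) g).
  by apply: eq_bigr => k _; rewrite /STFT -innerC//; exact: L2_tfshift.
pose M := (sqnorm f + sqnorm g) * limn (series w).
have b0 k z : nsq (inner f (tfshift z (eta k))) + nsq (inner (tfshift z (xi k)) g)
    <= (sqnorm f + sqnorm g) * (sqnorm (xi k) + sqnorm (eta k)).
  have h1 := cauchy_schwarz Lf (L2_tfshift z (Leta k)).
  have h2 := cauchy_schwarz (L2_tfshift z (Lxi k)) Lg.
  rewrite !sqnorm_tfshift// in h1 h2.
  have := mulr_ge0 (sqnorm_ge0 f) (sqnorm_ge0 (xi k)).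
  have := mulr_ge0 (sqnorm_ge0 g) (sqnorm_ge0 (eta k)).
  by nra.
have wlim n : series w n <= limn (series w).
  apply: nondecreasing_cvgn_le => //; apply/nondecreasing_seqP => m.
  rewrite /series/= big_nat_recr//= lerDl mulr_ge0//.
  by rewrite addr_ge0// sqnorm_ge0.
have M0 : 0 <= sqnorm f + sqnorm g by rewrite addr_ge0// sqnorm_ge0.
have sumb K (u : nat -> R) : (forall k, `|u k| <= (sqnorm f + sqnorm g) *
    (sqnorm (xi k) + sqnorm (eta k))) -> `|\sum_(k < K) s k * u k| <= M.
  move=> hu; apply: (le_trans (ler_norm_sum _ _ _)).
  apply: (@le_trans _ _ ((sqnorm f + sqnorm g) * series w K)).
    rewrite /series/= big_mkord mulr_sumr; apply: ler_sum => k _.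
    by rewrite normrM (ger0_norm (s0 k)) /w mulrCA ler_wpM2l.
  by rewrite ler_wpM2l.
have TM K z : `|Re (T K z)| <= M /\ `|Im (T K z)| <= M.
  rewrite TE Re_sum Im_sum; split.
    under eq_bigr do rewrite Re_Zreal.
    apply: (sumb K (fun k => Re (inner f (tfshift z (eta k)) * inner (tfshift z (xi k)) g))).
    by move=> k; exact: le_trans (normr_Re_mul _ _) (b0 k z).
  under eq_bigr do rewrite Im_Zreal.
  apply: (sumb K (fun k => Im (inner f (tfshift z (eta k)) * inner (tfshift z (xi k)) g))).
  by move=> k; exact: le_trans (normr_Im_mul _ _) (b0 k z).
have mT K : measurable_fun setT (Re \o T K) /\ measurable_fun setT (Im \o T K).
  have mk k : measurable_fun setT (Re \o (fun z => STFT (eta k) f z * (STFT (xi k) g z)^*%R)) /\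
      measurable_fun setT (Im \o (fun z => STFT (eta k) f z * (STFT (xi k) g z)^*%R)).
    have [a1 a2] := measurable_STFT Lf (Leta k).
    have [b1 b2] := measurable_STFT Lg (Lxi k).
    have b1' : measurable_fun setT (Re \o (fun z => (STFT (xi k) g z)^*%R)).
      rewrite (_ : _ \o _ = Re \o STFT (xi k) g); first exact: b1.
      by apply/funext => z; exact: ReJ.
    have b2' : measurable_fun setT (Im \o (fun z => (STFT (xi k) g z)^*%R)).
      rewrite (_ : _ \o _ = (fun t => - t) \o (Im \o STFT (xi k) g)).
        exact: (measurableT_comp (@oppr_measurable R setT) b2).
      by apply/funext => z; exact: ImJ.
    exact: measurable_cmul a1 a2 b1' b2'.
  split.
    rewrite (_ : _ \o _ = fun z => \sum_(k < K) s k *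
        (Re \o (fun z => STFT (eta k) f z * (STFT (xi k) g z)^*%R)) z).
      apply: measurable_sum => k; apply: measurable_funM => //; exact: (mk k).1.
    by apply/funext => z; rewrite /= Re_sum; apply: eq_bigr => k _; rewrite Re_Zreal.
  rewrite (_ : _ \o _ = fun z => \sum_(k < K) s k *
      (Im \o (fun z => STFT (eta k) f z * (STFT (xi k) g z)^*%R)) z).
    apply: measurable_sum => k; apply: measurable_funM => //; exact: (mk k).2.
  by apply/funext => z; rewrite /= Im_sum; apply: eq_bigr => k _; rewrite Im_Zreal.
have cT z : Ccvg (T ^~ z) (inner (alpha z S f) g).
  have := nuclear_alpha z Lf Lg; congr (Ccvg _ _).
  by apply/funext => K; rewrite TE.
split.
  apply: (@bmeas_lim _ _ _ (fun K z => Re (T K z)) _ M).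
  - by move=> K; split; [exact: (mT K).1|exists M => z; exact: (TM K z).1].
  - by move=> K z; exact: (TM K z).1.
  - by move=> z; exact: (cT z).1.
apply: (@bmeas_lim _ _ _ (fun K z => Im (T K z)) _ M).
- by move=> K; split; [exact: (mT K).2|exists M => z; exact: (TM K z).2].
- by move=> K z; exact: (TM K z).2.
- by move=> z; exact: (cT z).2.
Qed.

Section resolved.
Variables (I : nat -> finType) (e : forall N, I N -> Rd -> C).
Arguments e : clear implicits.
Hypothesis re : resolution e.
Variable zeta : Z.
Let Le N i : L2 (e N i). Proof. by case: re. Qed.

(* A partial sum of the trace of [pi(- zeta) alpha_z(S)]. *)
Definition partial_trace N z : C :=
  \sum_i inner (alpha z S (e N i)) (tfshift_adj (- zeta) (e N i)).

(** By the nuclear expansion of [S], [partial_trace N z] is a series in [k]. As [N] grows, the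
    resolution sends its terms to [s k * <pi(- zeta) pi(z) xi_k, pi(z) eta_k>], while Bessel's
    inequality bounds them by [w k], whatever [N] and [z]; [Ctannery] then exchanges the limits.
    Commuting the two shifts and cancelling the unitary [pi(z)] confines [z] to a phase. *)
Lemma partial_trace_cvg : exists2 c : C,
  Ccvg (fun K => \sum_(k < K) (s k)%:C * inner (tfshift (- zeta) (xi k)) (eta k)) c &
  (forall z, Ccvg (partial_trace ^~ z) (expi (- (2 * pi * sympl zeta z)) * c)) /\
  exists M, forall N z, `|Re (partial_trace N z)| <= M /\ `|Im (partial_trace N z)| <= M.
Proof.
pose U z k := tfshift (- zeta) (tfshift z (xi k)).
pose V z k := tfshift z (eta k).
have LU z k : L2 (U z k) by do 2 apply: L2_tfshift.
have LV z k : L2 (V z k) by exact: L2_tfshift.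
pose a z N k : C := (s k)%:C *
  (\sum_i inner (U z k) (e N i) * inner (e N i) (V z k)).
have aw z N k : `|Re (a z N k)| <= w k /\ `|Im (a z N k)| <= w k.
  have [_ bessel _] := re.
  have B : \sum_i (nsq (inner (U z k) (e N i)) + nsq (inner (e N i) (V z k))) <=
      sqnorm (xi k) + sqnorm (eta k).
    rewrite big_split/= -(sqnorm_tfshift z (Lxi k)) -(sqnorm_tfshift (- zeta) (L2_tfshift z (Lxi k))).
    rewrite -(sqnorm_tfshift z (Leta k)); apply: lerD; first exact: bessel.
    under eq_bigr do rewrite (nsq_innerC (LV z k) (Le _)).
    exact: bessel.
  rewrite Re_Zreal Im_Zreal !normrM (ger0_norm (s0 k)) Re_sum Im_sum.
  split; rewrite ler_wpM2l// (le_trans (ler_norm_sum _ _ _))// (le_trans _ B)//;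
    apply: ler_sum => i _; [exact: normr_Re_mul|exact: normr_Im_mul].
pose l z k : C := (s k)%:C * inner (U z k) (V z k).
have al z k : Ccvg (a z ^~ k) (l z k).
  by apply: CcvgM; [exact: Ccvg_cst|case: re => _ _; apply].
have sa z N : Ccvg (fun K => \sum_(k < K) a z N k) (partial_trace N z).
  rewrite (_ : (fun K => _) = fun K => \sum_i \sum_(k < K) (s k)%:C *
      (inner (e N i) (tfshift z (eta k)) *
       inner (tfshift z (xi k)) (tfshift_adj (- zeta) (e N i)))).
    apply: Ccvg_sum => i; apply: nuclear_alpha => //; exact: L2_tfshift_adj.
  apply/funext => K; rewrite exchange_big/=; apply: eq_bigr => k _.
  rewrite /a mulr_sumr; apply: eq_bigr => i _; congr (_ * _).
  rewrite [LHS]mulrC; congr (_ * _); apply: inner_tfshiftl => //.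
  exact: L2_tfshift.
have H z := Ctannery (aw z) cw (al z) (sa z).
(* At [z = 0] the limit is the trace of [pi(- zeta) S], in a form that involves no basis. *)
have [c c1 _] := H 0; exists c.
  move: c1; congr (Ccvg _ _); apply/funext => K; apply: eq_bigr => k _.
  by rewrite /l /U /V !tfshift0.
split; last by exists (limn (series w)) => N z; have [L _ [_]] := H z; apply.
move=> z; have [L L1 [cL _]] := H z.
suff -> : expi (- (2 * pi * sympl zeta z)) * c = L by [].
apply: (Ccvg_unique (CcvgM (Ccvg_cst _) c1)).
move: L1; congr (Ccvg _ _); apply/funext => K; rewrite mulr_sumr; apply: eq_bigr => k _.
rewrite /l mulrCA; congr (_ * _); rewrite /U /V !tfshift0 tfshift_commute innerZl//.
- by rewrite inner_tfshift//; exact: L2_tfshift.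
- by do 2 apply: L2_tfshift.
- exact: L2_tfshift.
Qed.

Variables (B B' : set Z).
Hypotheses (mB : measurable B) (mB' : measurable B').
Hypotheses (Boo : (muZ B < +oo)%E) (Boo' : (muZ B' < +oo)%E).

(** Each partial trace is a finite sum of matrix coefficients of [alpha z S], so its [int_diff] is
    0; dominated convergence carries this to the limit [E], a complex exponential times the nonzero
    constant [c]. *)
Lemma int_diff_trig (c : C) :
  (forall f g, L2 f -> L2 g ->
    int_diff muZ B B' (fun z => Re (inner (alpha z S f) g)) = 0 /\
    int_diff muZ B B' (fun z => Im (inner (alpha z S f) g)) = 0) ->
  Ccvg (fun K => \sum_(k < K) (s k)%:C * inner (tfshift (- zeta) (xi k)) (eta k)) c ->
  c != 0 ->
  forall theta, int_diff muZ B B' (trig (zeta, theta)) = 0.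
Proof.
move=> h0 c1 cneq0 theta.
have [c' /(Ccvg_unique c1) <- [ptc [M ptM]]] := partial_trace_cvg.
have bsum (J : finType) (F : J -> Z -> R) : (forall j, bmeas (F j)) ->
    (forall j, int_diff muZ B B' (F j) = 0) ->
    bmeas (fun z => \sum_j F j z) /\ int_diff muZ B B' (fun z => \sum_j F j z) = 0.
  move=> bF F0; elim: (index_enum J) => [|j r [b0 i0]].
    rewrite (_ : (fun _ => _) = cst 0); last by apply/funext => z; rewrite big_nil.
    by split; [exact: bmeas_cst|rewrite /int_diff !Rintegral_cst// !mul0r subrr].
  rewrite (_ : (fun _ => _) = fun z => F j z + \sum_(i <- r) F i z).
    by split; [exact: bmeasD|rewrite int_diffD ?F0 ?i0 ?addr0].
  by apply/funext => z; rewrite big_cons.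
have bpt N : [/\ bmeas (fun z => Re (partial_trace N z)),
    bmeas (fun z => Im (partial_trace N z)),
    int_diff muZ B B' (fun z => Re (partial_trace N z)) = 0 &
    int_diff muZ B B' (fun z => Im (partial_trace N z)) = 0].
  have Lg i : L2 (tfshift_adj (- zeta) (e N i)) by exact: L2_tfshift_adj.
  have [] := bsum _ (fun i z => Re (inner (alpha z S (e N i)) (tfshift_adj (- zeta) (e N i)))).
  - by move=> i; exact: (bmeas_nuclear_alpha _ _).1.
  - by move=> i; exact: (h0 _ _ _ _).1.
  have [] := bsum _ (fun i z => Im (inner (alpha z S (e N i)) (tfshift_adj (- zeta) (e N i)))).
  - by move=> i; exact: (bmeas_nuclear_alpha _ _).2.
  - by move=> i; exact: (h0 _ _ _ _).2.
  move=> i1 i0 r1 r0.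
  have ReE : (fun z => Re (partial_trace N z)) = fun z =>
      \sum_i Re (inner (alpha z S (e N i)) (tfshift_adj (- zeta) (e N i))).
    by apply/funext => z; rewrite -Re_sum.
  have ImE : (fun z => Im (partial_trace N z)) = fun z =>
      \sum_i Im (inner (alpha z S (e N i)) (tfshift_adj (- zeta) (e N i))).
    by apply/funext => z; rewrite -Im_sum.
  by rewrite ReE ImE; split; [exact: r1|exact: i1|exact: r0|exact: i0].
pose E z := expi (- (2 * pi * sympl zeta z)) * c.
have E1 : int_diff muZ B B' (fun z => Re (E z)) = 0.
  apply: (@int_diff_lim0 _ _ _ _ _ _ mB mB' Boo Boo' (fun N z => Re (partial_trace N z)) _ M).
  - by move=> N; have [] := bpt N.
  - by move=> N z; have [] := ptM N z.
  - by move=> z; exact: (ptc z).1.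
  - by move=> N; have [] := bpt N.
have E2 : int_diff muZ B B' (fun z => Im (E z)) = 0.
  apply: (@int_diff_lim0 _ _ _ _ _ _ mB mB' Boo Boo' (fun N z => Im (partial_trace N z)) _ M).
  - by move=> N; have [] := bpt N.
  - by move=> N z; have [] := ptM N z.
  - by move=> z; exact: (ptc z).2.
  - by move=> N; have [] := bpt N.
have c0 : nsq c != 0 by apply: contra cneq0 => /eqP/nsq_eq0 ->.
have EE z : expi (- (2 * pi * sympl zeta z)) = cos (2 * pi * sympl zeta z) +i* (- sin (2 * pi * sympl zeta z)).
  by rewrite /expi cosN sinN.
have bE1 : bmeas (fun z => Re (E z)).
  apply: (@bmeas_lim _ _ _ (fun N z => Re (partial_trace N z)) _ M).
  - by move=> N; have [] := bpt N.
  - by move=> N z; have [] := ptM N z.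
  - by move=> z; exact: (ptc z).1.
have bE2 : bmeas (fun z => Im (E z)).
  apply: (@bmeas_lim _ _ _ (fun N z => Im (partial_trace N z)) _ M).
  - by move=> N; have [] := bpt N.
  - by move=> N z; have [] := ptM N z.
  - by move=> z; exact: (ptc z).2.
(* [p] and [q] are the parts of [c * expi theta / nsq c], whose product with the conjugate of [E z]
   is [expi (2 * pi * sympl zeta z + theta)]; the real part of that product is
   [p * Re (E z) + q * Im (E z)]. *)
pose p := (Re c * cos theta - Im c * sin theta) / nsq c.
pose q := (Im c * cos theta + Re c * sin theta) / nsq c.
have -> : trig (zeta, theta) = fun z => p * Re (E z) + q * Im (E z).
  apply/funext => z; rewrite /trig /E EE !ReImE/= cosD /p /q.
  by rewrite /nsq in c0 *; field.
rewrite int_diffD ?int_diffZ ?E1 ?E2 ?mulr0 ?addr0//;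
  by apply: bmeasM => //; exact: bmeas_cst.
Qed.

End resolved.
End nuclear_operator.
End trace_formula.

(** * Reduction of both statements to nuclear operators *)

Section assembly.
Variables (R : realType) (d : nat).
Local Notation C := R[i].
Local Notation Re := (@complex.Re R).
Local Notation Im := (@complex.Im R).
Local Notation Rd := 'rV[R]_d.
Local Notation Z := (Rd * Rd)%type.
Local Notation mu := (lebesgue_rV R d).
Local Notation muZ := (mu \x mu)%E.
Implicit Types (f g : Rd -> C) (z zeta : Z).

Lemma L2cvg_weak (s : nat -> C) (xi : nat -> Rd -> C) f g :
  (forall n, L2 (xi n)) -> L2 f -> L2 g ->
  L2cvg (fun N t => \sum_(n < N) s n * xi n t) f ->
  Ccvg (fun N => \sum_(n < N) s n * inner (xi n) g) (inner f g).
Proof.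
move=> Lxi Lf Lg cvg; pose u N t := \sum_(n < N) s n * xi n t.
have Lu N : L2 (u N) by apply: L2_sum => n; exact: L2Z.
have := inner_cvgl Lu Lf Lg (L2cvg_sqnorm Lu Lf cvg).
congr (Ccvg _ _); apply/funext => N.
rewrite inner_suml//; last by move=> n; exact: L2Z.
by apply: eq_bigr => n _; rewrite innerZl.
Qed.

(** Bessel's inequality comes from the weak expansion at [g = f]: the partial sums are nondecreasing
    and converge to [sqnorm f]. *)
Lemma orthonormal_resolution (e : nat -> Rd -> C) : orthonormal_basis e ->
  resolution (fun N (i : 'I_N) => e i).
Proof.
move=> [Le _ cvge].
have weak f g : L2 f -> L2 g ->
    Ccvg (fun N => \sum_(i < N) inner f (e i) * inner (e i) g) (inner f g).
  by move=> Lf Lg; exact: (@L2cvg_weak (fun n => inner f (e n)) e f g Le Lf Lg (cvge _ Lf)).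
split=> // N f Lf; have [h _] := weak f f Lf Lf.
have E n : Re (\sum_(i < n) inner f (e i) * inner (e i) f) = \sum_(i < n) nsq (inner f (e i)).
  rewrite Re_sum; apply: eq_bigr => i _.
  by rewrite [inner (e i) f]innerC// mulJ_nsq.
rewrite -E -[leRHS](cvg_lim (@Rhausdorff R) h).
apply: (@nondecreasing_cvgn_le _ (Re \o _)); last by apply/cvg_ex; eexists; exact: h.
apply/nondecreasing_seqP => n /=.
by rewrite !E big_ord_recr/= lerDl nsq_ge0.
Qed.

Lemma trace_class_nuclear S : trace_class S ->
  exists s xi eta, @nuclear R d S s xi eta.
Proof.
move=> [[LS _ _ _] [s [xi [eta [s0 cs L on cvgS]]]]].
exists s, xi, eta; split => //.
  (* If [s k != 0] both vectors have norm 1; otherwise the term is 0 whatever the vectors are. *)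
  rewrite (_ : (fun k => _) = 2 *: s); first exact: is_cvg_seriesZ.
  apply/funext => k; rewrite /GRing.scale/= mulrC; have [->|sk] := eqVneq (s k) 0; first by rewrite mulr0 scaler0.
  by have [h1 h2] := on k k sk sk; rewrite /sqnorm h1 h2 eqxx mulr1n.
move=> f g Lf Lg; have := @L2cvg_weak (fun n => (s n)%:C * inner f (eta n)) xi (S f) g
  (fun n => (L n).1) (LS _ Lf) Lg (cvgS _ Lf).
congr (Ccvg _ _); apply/funext => N.
by apply: eq_bigr => n _; rewrite mulrA.
Qed.

(** A nonzero trace is not the default value of [xget], so it is the sum along some orthonormal
    basis. That basis is a resolution, and [partial_trace_cvg] at [z = 0] shows that the sum would
    be 0 if [c] were. *)
Lemma Fourier_Wigner_neq0 S s xi eta zeta : nuclear S s xi eta ->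
  Fourier_Wigner S zeta != 0 ->
  exists2 c : C, c != 0 &
    Ccvg (fun K => \sum_(k < K) (s k)%:C * inner (tfshift (- zeta) (xi k)) (eta k)) c.
Proof.
move=> nS; rewrite mulf_eq0 negb_or => /andP[_]; rewrite /trace.
set P := (X in xget _ X); have [[t Pt]|P0] := pselect (exists t, P t); last first.
  by rewrite xgetPN ?eqxx// => x Px; apply: P0; exists x.
move: {t Pt} (xgetI 0 Pt) => [e [one cvg]] t0.
have [c cc [/(_ 0) c0 _]] := partial_trace_cvg nS (orthonormal_resolution one) zeta.
exists c => //; apply: contra_neq t0 => c00.
rewrite c00 mulr0 in c0; apply: Ccvg_unique cvg _; move: c0.
have [Le _ _] := one; have [_ _ _ LS _] := nS.
congr (Ccvg _ _); apply/funext => N; apply: eq_bigr => i _.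
by rewrite alpha0 inner_tfshiftl//; exact: LS.
Qed.

Lemma Cintegral_chi Omega B (F : Z -> C) :
  measurable B -> muZ.-negligible (Omega `+` B) ->
  Cintegral muZ setT (fun z => chi Omega z * F z) =
  (\int[muZ]_(z in B) Re (F z))%R +i* (\int[muZ]_(z in B) Im (F z))%R.
Proof.
move=> mB [N [mN N0 NB]].
have E z : ~ N z -> (z \in Omega) = (z \in B).
  move=> Nz; apply/idP/idP => /set_mem zO; apply/mem_set; apply: contrapT => zB;
    apply: Nz; apply: NB; by [left|right].
have H (G : Z -> R) : (\int[muZ]_z (\1_Omega z * G z))%R = (\int[muZ]_(z in B) G z)%R.
  rewrite [RHS]Rintegral_mkcond /Rintegral; congr fine.
  apply: (@eq_integral_off_null _ _ _ muZ N (fun z => (\1_Omega z * G z)%:E)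
    (fun z => ((G \_ B) z)%:E) mN N0) => z Nz.
  rewrite patchE indicE (E _ Nz); case: (_ \in _); by rewrite ?mul1r ?mul0r.
rewrite /Cintegral; congr (_ +i* _).
  by rewrite -H; apply: eq_Rintegral => z _; rewrite Re_Zreal.
by rewrite -H; apply: eq_Rintegral => z _; rewrite Im_Zreal.
Qed.

(** The common core of both statements: it is applied to a singular value decomposition for the
    first, and to a rank one operator for the second. *)
Lemma nuclear_determines S s xi eta (D : set Z) (I : nat -> finType)
    (e : forall N, I N -> Rd -> C) Omega Omega' :
  nuclear S s xi eta -> resolution e -> dense D ->
  (forall zeta, D zeta -> exists2 c : C, c != 0 &
    Ccvg (fun K => \sum_(k < K) (s k)%:C * inner (tfshift (- zeta) (xi k)) (eta k)) c) ->
  finite_Lebesgue_measure Omega -> finite_Lebesgue_measure Omega' ->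
  (forall f g, L2 f -> L2 g ->
    Cintegral muZ setT (fun z => chi Omega z * inner (alpha z S f) g) =
    Cintegral muZ setT (fun z => chi Omega' z * inner (alpha z S f) g)) ->
  muZ.-negligible (Omega `+` Omega').
Proof.
move=> nS re dD cD [B [mB Boo OB]] [B' [mB' Boo' OB']] h.
have BB' : muZ (B `+` B') = 0%E.
  apply: (trigonometric_uniqueness mB mB' Boo Boo' dD) => zeta /cD[c c0 cc].
  apply: (int_diff_trig nS re mB mB' Boo Boo' _ cc c0) => f g Lf Lg.
  have := h f g Lf Lg; rewrite (Cintegral_chi _ mB OB) (Cintegral_chi _ mB' OB').
  move=> [h1 h2]; split; [move: h1|move: h2]; rewrite /int_diff => ->; exact: subrr.
have nBB' : muZ.-negligible (B `+` B').
  exists (B `+` B'); split => //.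
  by apply: measurableU; exact: measurableD.
apply: (@negligibleS _ _ _ _ ((Omega `+` B) `|` (B `+` B') `|` (Omega' `+` B'))).
  move=> z [[zO zO']|[zO' zO]].
  - have [zB|zB] := pselect (B z); last by left; left; left.
    have [zB'|zB'] := pselect (B' z); last by left; right; left.
    by right; right.
  - have [zB'|zB'] := pselect (B' z); last by right; left.
    have [zB|zB] := pselect (B z); last by left; right; right.
    by left; left; right.
by apply: negligibleU => //; apply: negligibleU.
Qed.

Lemma rank_one_nuclear (phi1 phi2 : Rd -> C) : L2 phi1 -> L2 phi2 ->
  nuclear (fun f t => inner f phi1 * phi2 t) (fun k => (k == 0)%:R)
    (fun=> phi2) (fun=> phi1).
Proof.
move=> L1 L2'; split => //.
- pose a := sqnorm phi2 + sqnorm phi1.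
  apply/cvg_ex; exists a; apply: cvg_near_cst; exists 1%N => // n /= n0.
  rewrite /series/= big_mkord (bigD1 (Ordinal n0))//= mul1r big1 ?addr0 ?eqxx//.
  by move=> i; rewrite -val_eqE/= => /negbTE ->; rewrite mul0r.
- by move=> f Lf; exact: L2Z.
- move=> f g Lf Lg; rewrite innerZl//.
  have E K : (0 < K)%N -> \sum_(k < K) ((k == 0 :> nat)%:R : R)%:C * (inner f phi1 * inner phi2 g) =
      inner f phi1 * inner phi2 g.
    move=> K0; rewrite (bigD1 (Ordinal K0))//= mul1r big1 ?addr0//.
    by move=> i; rewrite -val_eqE/= => /negbTE ->; rewrite mul0r.
  by split; apply: cvg_near_cst; exists 1%N => // K /= K0; rewrite E.
Qed.

(** The adjoint of [pi(zeta)] is [pi(- zeta)] up to a phase, so the two numbers differ only by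
    phases. *)
Lemma cross_ambiguity_neq0 (phi1 phi2 : Rd -> C) zeta : L2 phi1 -> L2 phi2 ->
  cross_ambiguity phi2 phi1 zeta != 0 ->
  inner (tfshift (- zeta) phi2) phi1 != 0.
Proof.
move=> L1 L2'; rewrite /cross_ambiguity /STFT mulf_eq0 negb_or => /andP[_].
apply: contra => /eqP h; rewrite -inner_tfshift_adjl// tfshift_adjE innerZl//.
  by rewrite h mulr0.
exact: L2_tfshift.
Qed.

Lemma localization_alpha (phi1 phi2 : Rd -> C) f z : L2 phi1 -> L2 f ->
  alpha z (fun f t => inner f phi1 * phi2 t) f =
  fun t => STFT phi1 f z * tfshift z phi2 t.
Proof.
move=> L1 Lf; apply/funext => t; rewrite /alpha /STFT -inner_tfshift_adjl//.
by rewrite {1 2}/tfshift mulrCA.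
Qed.

Lemma Cintegral_mkcond Omega (F : Z -> C) :
  Cintegral muZ Omega F = Cintegral muZ setT (fun z => chi Omega z * F z).
Proof.
rewrite /Cintegral; congr (_ +i* _); rewrite [LHS]Rintegral_mkcond;
  apply: eq_Rintegral => z _; rewrite patchE ?Re_Zreal ?Im_Zreal indicE;
  by case: (_ \in _); rewrite ?mul1r ?mul0r.
Qed.

Lemma Cintegral_localization Omega (phi1 phi2 : Rd -> C) f g :
  L2 phi1 -> L2 phi2 -> L2 f -> L2 g ->
  Cintegral muZ Omega (fun z => STFT phi1 f z * inner (tfshift z phi2) g) =
  Cintegral muZ setT (fun z => chi Omega z *
    inner (alpha z (fun f t => inner f phi1 * phi2 t) f) g).
Proof.
move=> L1 L2' Lf Lg.
rewrite Cintegral_mkcond; congr Cintegral; apply/funext => z; congr (_ * _).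
by rewrite (localization_alpha phi2 z L1 Lf) (innerZl _ (L2_tfshift z L2') Lg).
Qed.

End assembly.

(** * A resolution of the identity *)

Section indicators.
Variables (R : realType) (d : nat).
Local Notation C := R[i].
Local Notation Re := (@complex.Re R).
Local Notation Im := (@complex.Im R).
Local Notation Rd := 'rV[R]_d.
Local Notation mu := (lebesgue_rV R d).
Implicit Types (f g u v : Rd -> C) (A B : set Rd).

Lemma Ccvg_nsq0 (z : nat -> C) (l : C) : Ccvg z l ->
  nsq (z n - l) @[n --> \oo] --> 0.
Proof.
move=> [/subr_cvg0 h1 /subr_cvg0 h2].
have H : (fun n => (Re (z n) - Re l) * (Re (z n) - Re l) +
    (Im (z n) - Im l) * (Im (z n) - Im l)) @ \oo --> (0 : R).
  by have := cvgD (cvgM h1 h1) (cvgM h2 h2); rewrite mulr0 addr0; exact.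
rewrite (_ : (fun n => nsq _) = fun n =>
  (Re (z n) - Re l) * (Re (z n) - Re l) +
  (Im (z n) - Im l) * (Im (z n) - Im l)); first exact: H.
by apply/funext => n; rewrite /nsq !expr2 !ReImE.
Qed.

Definition cindic A : Rd -> C := fun t => (\1_A t)%:C.

Lemma L2_real (u : Rd -> R) : measurable_fun setT u ->
  mu.-integrable setT (EFin \o (fun t => u t ^+ 2)) -> L2 (fun t => (u t)%:C).
Proof.
move=> m1 iu; apply: (@L2_dominated _ _ _ (fun t => u t ^+ 2)) => //.
  exact: measurable_cst.
by move=> t; rewrite nsqr.
Qed.

Lemma L2_cindic A : measurable A -> (mu A < +oo)%E -> L2 (cindic A).
Proof.
move=> mA Aoo; apply: L2_real; first exact: measurable_indic.
rewrite (_ : _ \o _ = EFin \o \1_A); last first.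
  by apply/funext => t /=; rewrite indicE; case: (_ \in _); rewrite ?expr1n ?expr0n.
apply/integrableP; split; first by apply/measurable_EFinP; exact: measurable_indic.
rewrite (_ : (fun x => _) = fun x => (\1_A x)%:E); last first.
  by apply/funext => t /=; rewrite indicE; case: (_ \in _); rewrite ?normr1 ?normr0.
by rewrite integral_indic ?setIT.
Qed.

Lemma inner_cindic A B : measurable A -> measurable B ->
  inner (cindic A) (cindic B) = (fine (mu (A `&` B)))%:C.
Proof.
move=> mA mB.
rewrite /inner (_ : (fun t => _) = cindic (A `&` B)); last first.
  apply/funext => t; rewrite /cindic indicI/=; apply: complex_ext => /=; ring.
apply: complex_ext => /=; last by rewrite Rintegral_cst// mul0r.
by rewrite /Rintegral integral_indic ?setIT//; exact: measurableI.
Qed.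

Lemma sqnorm_cindic A : measurable A -> sqnorm (cindic A) = fine (mu A).
Proof. by move=> mA; rewrite /sqnorm inner_cindic// setIid. Qed.

Lemma sqnorm_dominated_cvg (u_ : nat -> Rd -> C) u (g : Rd -> R) :
  (forall n, L2 (u_ n)) -> L2 u -> mu.-integrable setT (EFin \o g) ->
  (forall t, Ccvg (u_ ^~ t) (u t)) ->
  (forall n t, nsq (u_ n t - u t) <= g t) ->
  sqnorm (fun t => u_ n t - u t) @[n --> \oo] --> 0.
Proof.
move=> Lu_ Lu ig ut bnd.
have [] := @Rintegral_dominated _ _ _ mu setT (fun n t => nsq (u_ n t - u t)) (cst 0) g.
- by [].
- move=> n; have := L2B (Lu_ n) Lu; case=> m1 m2 _; exact: (measurable_nsq m1 m2).
- move=> t _; exact: Ccvg_nsq0.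
- exact: ig.
- by move=> n t _; rewrite ger0_norm ?nsq_ge0.
move=> _; rewrite Rintegral_cst// mul0r.
by under [X in _ -> X @ _ --> _]eq_fun do rewrite sqnormE.
Qed.

(** The last hypothesis weakens normalization so as to admit zero vectors, which is what atoms of
    measure zero give. The sum is then the orthogonal projection of [f], and the inequality says
    that [f] minus its projection has nonnegative squared norm. *)
Lemma bessel (I : finType) (e : I -> Rd -> C) f :
  (forall i, L2 (e i)) -> L2 f ->
  (forall i j, i != j -> inner (e i) (e j) = 0) ->
  (forall i, inner f (e i) * inner (e i) (e i) = inner f (e i)) ->
  \sum_i nsq (inner f (e i)) = sqnorm (fun t => \sum_i inner f (e i) * e i t) /\
  \sum_i nsq (inner f (e i)) <= sqnorm f.
Proof.
move=> Le Lf orth norm.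
pose P t := \sum_i inner f (e i) * e i t.
have LP : L2 P by apply: L2_sum => i; exact: L2Z.
have Pg g : L2 g -> inner P g = \sum_i inner f (e i) * inner (e i) g.
  move=> Lg; rewrite inner_suml//; last by move=> i; exact: L2Z.
  by apply: eq_bigr => i _; rewrite innerZl.
have Pf : inner P f = (\sum_i nsq (inner f (e i)))%:C.
  rewrite Pg// (big_morph (fun r : R => r%:C) (id1 := 0) (op1 := +%R))//; last first.
    by move=> x y; apply: complex_ext; rewrite /= ?addr0.
  by apply: eq_bigr => i _; rewrite [inner (e i) f]innerC// mulJ_nsq.
have Pe i : inner P (e i) = inner f (e i).
  rewrite Pg// (bigD1 i)//= norm big1 ?addr0// => j ji.
  by rewrite orth ?mulr0.
have PP : inner P P = inner P f.
  by rewrite !Pg//; apply: eq_bigr => i _; rewrite [inner (e i) P]innerC// Pe -innerC.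
have Ps : \sum_i nsq (inner f (e i)) = sqnorm P by rewrite /sqnorm PP Pf.
split => //.
have := sqnorm_ge0 (fun t => f t - P t); rewrite sqnormB// -Ps.
rewrite (_ : Re (inner f P) = \sum_i nsq (inner f (e i))); first lra.
by rewrite innerC// Pf.
Qed.

End indicators.

(** * Projections on the atoms of a finite algebra of sets *)

Section atoms.
Variables (R : realType) (d : nat).
Local Notation C := R[i].
Local Notation Re := (@complex.Re R).
Local Notation Im := (@complex.Im R).
Local Notation Rd := 'rV[R]_d.
Local Notation mu := (lebesgue_rV R d).
Implicit Types (f g u v : Rd -> C) (A B E : set Rd).

Variable F : nat -> set Rd.
Hypothesis mF : forall n, measurable (F n).
Hypothesis Foo : forall n, (mu (F n) < +oo)%E.

(* The nonzero codes of length [k] label the atoms of the algebra generated by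
   [F 0, .., F k.-1] that lie in the union of these sets. *)
Definition code k (x : Rd) : {ffun 'I_k -> bool} := [ffun j : 'I_k => x \in F j].
Definition code0 k : {ffun 'I_k -> bool} := [ffun=> false].

(** The code [code0 k] yields the empty set and not the complement of the union, whose measure may
    be infinite. *)
Definition cell k (J : {ffun 'I_k -> bool}) : set Rd :=
  [set x | J != code0 k /\ code k x = J].

Lemma measurable_cell k (J : {ffun 'I_k -> bool}) : measurable (cell J).
Proof.
have [->|J0] := eqVneq J (code0 k).
  by rewrite (_ : cell _ = set0)//; apply/seteqP; split => x //= []; rewrite eqxx.
rewrite (_ : cell J = \bigcap_(j : 'I_k) (if J j then F j else ~` F j)).
  apply: fin_bigcap_measurable => // j _.
  by case: ifP => _ //; exact: measurableC.
apply/seteqP; split => x /=.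
  move=> [_ <-] j _; rewrite ffunE; case: ifPn => [/set_mem//|].
  by rewrite notin_setE.
move=> h; split => //; apply/ffunP => j; rewrite ffunE.
by have := h j I; by case: (J j) => hx; [rewrite mem_set|rewrite memNset].
Qed.

Lemma cell_lty k (J : {ffun 'I_k -> bool}) : (mu (cell J) < +oo)%E.
Proof.
have [[j Jj]|h] := pselect (exists j, J j).
  apply: le_lt_trans (Foo j); apply: le_measure; rewrite ?inE//; first exact: measurable_cell.
  by move=> x /= [_ cx]; move: Jj; rewrite -cx ffunE => /set_mem.
rewrite (_ : cell J = set0) ?measure0//; apply/seteqP; split => x //= [/eqP J0 _].
apply: J0; apply/ffunP => j; rewrite ffunE; apply/negbTE/negP => Jj.
by apply: h; exists j.
Qed.

Let m k (J : {ffun 'I_k -> bool}) : R := fine (mu (cell J)).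

(** On a cell of measure zero the convention that 0 is its own inverse makes this the zero
    function. *)
Definition atom_fun k (J : {ffun 'I_k -> bool}) : Rd -> C :=
  fun t => ((Num.sqrt (m J))^-1)%:C * cindic (cell J) t.

Let Lcell k (J : {ffun 'I_k -> bool}) : L2 (cindic (cell J)).
Proof. by apply: L2_cindic; [exact: measurable_cell|exact: cell_lty]. Qed.

Lemma L2_atom_fun k (J : {ffun 'I_k -> bool}) : L2 (atom_fun J).
Proof. exact: L2Z. Qed.

Lemma realJ (a : R) : (a%:C)^*%R = a%:C.
Proof. by apply: complex_ext; rewrite ?ReJ ?ImJ/= ?oppr0. Qed.

Lemma inner_atoml k (J : {ffun 'I_k -> bool}) v : L2 v ->
  inner (atom_fun J) v = ((Num.sqrt (m J))^-1)%:C * inner (cindic (cell J)) v.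
Proof. by move=> Lv; rewrite innerZl. Qed.

Lemma inner_atomr k (J : {ffun 'I_k -> bool}) v : L2 v ->
  inner v (atom_fun J) = ((Num.sqrt (m J))^-1)%:C * inner v (cindic (cell J)).
Proof. by move=> Lv; rewrite innerZr// realJ. Qed.

Lemma realM (a b : R) : a%:C * b%:C = (a * b)%:C.
Proof. by apply: complex_ext => /=; ring. Qed.

Let m_ge0 k (J : {ffun 'I_k -> bool}) : 0 <= m J.
Proof. exact: fine_ge0. Qed.

Lemma atom_fun_orthogonal k (J J' : {ffun 'I_k -> bool}) : J != J' ->
  inner (atom_fun J) (atom_fun J') = 0.
Proof.
move=> JJ'; rewrite inner_atoml ?inner_atomr//; last exact: L2_atom_fun.
rewrite inner_cindic; [|exact: measurable_cell..].
rewrite (_ : _ `&` _ = set0) ?measure0 ?mulr0//.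
apply/seteqP; split => x //= [[_ h1] [_ h2]].
by move: JJ'; rewrite -h1 -h2 eqxx.
Qed.

Lemma atom_fun_normalized k (J : {ffun 'I_k -> bool}) v : L2 v ->
  inner v (atom_fun J) * inner (atom_fun J) (atom_fun J) = inner v (atom_fun J).
Proof.
move=> Lv; have [m0|m0] := eqVneq (m J) 0.
  by rewrite inner_atomr// m0 sqrtr0 invr0 !mul0r.
rewrite [inner (atom_fun J) _]inner_atoml ?inner_atomr//; last exact: L2_atom_fun.
rewrite inner_cindic; [|exact: measurable_cell..].
rewrite setIid -/(m J) !realM mulrA -invfM -expr2 sqr_sqrtr// mulVf//.
by rewrite mulr1.
Qed.

Let proj N u t : C := \sum_(J : {ffun 'I_N -> bool}) inner u (atom_fun J) * atom_fun J t.

Let L2_proj N u : L2 u -> L2 (proj N u).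
Proof. by move=> Lu; apply: L2_sum => J; apply: L2Z; exact: L2_atom_fun. Qed.

Let inner_proj N u v : L2 u -> L2 v -> inner (proj N u) v =
  \sum_(J : {ffun 'I_N -> bool}) inner u (atom_fun J) * inner (atom_fun J) v.
Proof.
move=> Lu Lv; rewrite inner_suml//; last by move=> J; apply: L2Z; exact: L2_atom_fun.
by apply: eq_bigr => J _; rewrite innerZl//; exact: L2_atom_fun.
Qed.

Let proj_bessel N u : L2 u ->
  \sum_(J : {ffun 'I_N -> bool}) nsq (inner u (atom_fun J)) = sqnorm (proj N u) /\
  \sum_(J : {ffun 'I_N -> bool}) nsq (inner u (atom_fun J)) <= sqnorm u.
Proof.
move=> Lu; apply: bessel => //.
- by move=> J; exact: L2_atom_fun.
- exact: atom_fun_orthogonal.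
- by move=> J; exact: atom_fun_normalized.
Qed.

Let proj_bound N u v : L2 u -> L2 v ->
  nsq (inner (proj N u) v) <= sqnorm u * sqnorm v.
Proof.
move=> Lu Lv; have [h1 h2] := proj_bessel N Lu.
apply: le_trans (cauchy_schwarz (L2_proj N Lu) Lv) _.
by rewrite ler_wpM2r ?sqnorm_ge0// -h1.
Qed.

(** The vectors for which the atoms satisfy the weak Parseval identity. They form a closed subspace,
    which has to be shown to be all of [L2]. *)
Definition expandable u : Prop := L2 u /\ forall v, L2 v ->
  Ccvg (fun N => \sum_(J : {ffun 'I_N -> bool}) inner u (atom_fun J) * inner (atom_fun J) v)
    (inner u v).

Lemma expandableD u u' : expandable u -> expandable u' ->
  expandable (fun t => u t + u' t).
Proof.
move=> [Lu hu] [Lu' hu']; split=> [|v Lv]; first exact: L2D.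
rewrite innerDl//; have := CcvgD (hu v Lv) (hu' v Lv).
congr (Ccvg _ _); apply/funext => N; rewrite -big_split/=; apply: eq_bigr => J _.
by rewrite innerDl ?mulrDl//; exact: L2_atom_fun.
Qed.

Lemma expandableZ (a : C) u : expandable u -> expandable (fun t => a * u t).
Proof.
move=> [Lu hu]; split=> [|v Lv]; first exact: L2Z.
rewrite innerZl//; have := CcvgM (Ccvg_cst a) (hu v Lv).
congr (Ccvg _ _); apply/funext => N; rewrite mulr_sumr; apply: eq_bigr => J _.
by rewrite innerZl ?mulrA//; exact: L2_atom_fun.
Qed.

Lemma expandable0 : expandable (fun _ : Rd => 0 : C).
Proof.
split=> [|v Lv]; first exact: L2_0.
rewrite inner0l//; have := Ccvg_cst (0 : C); congr (Ccvg _ _); apply/funext => N.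
by rewrite big1// => J _; rewrite inner0l ?mul0r//; exact: L2_atom_fun.
Qed.

Lemma expandable_sum I (r : seq I) (G : I -> Rd -> C) :
  (forall i, expandable (G i)) -> expandable (fun t => \sum_(i <- r) G i t).
Proof.
move=> hG; elim: r => [|i r IH].
  by under eq_fun do rewrite big_nil; exact: expandable0.
by under eq_fun do rewrite big_cons; exact: expandableD.
Qed.

(** Bessel's inequality bounds the projections uniformly in [N], so a small error [u_ n - u] remains
    small after projection, at every level at once. *)
Lemma expandable_lim (u_ : nat -> Rd -> C) u :
  (forall n, expandable (u_ n)) -> L2 u ->
  sqnorm (fun t => u_ n t - u t) @[n --> \oo] --> 0 -> expandable u.
Proof.
move=> hu_ Lu ucvg; split => // v Lv; apply: Ccvg_nsq; apply/cvgrPdist_lt => eps eps0.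
pose V := sqnorm v; have V0 : 0 <= V by exact: sqnorm_ge0.
(* Applying [nsqD_le] twice gives a factor 4 on the error terms, of which there are two, with and
   without projection, each at most [sqnorm (u_ n - u) * V]; hence 8. *)
have [n hn] : exists n, 8 * (sqnorm (fun t => u_ n t - u t) * V) < eps / 2.
  have : (fun n => 8 * (sqnorm (fun t => u_ n t - u t) * V)) @ \oo --> 8 * (0 * V).
    by apply: cvgM; [exact: cvg_cst|apply: cvgM => //; exact: cvg_cst].
  rewrite mul0r mulr0 => /cvgr_lt /(_ (eps / 2)).
  by rewrite divr_gt0// => /(_ isT)[n _ /(_ n (leqnn n))]; exists n.
have [Lun /(_ v Lv) hun] := hu_ n.
have LD : L2 (fun t => u_ n t - u t) by exact: L2B.
have e4 : 0 < eps / 4 by rewrite divr_gt0.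
have := Ccvg_nsq0 hun => /cvgr_lt /(_ _ e4); apply: filterS => N.
rewrite -!inner_proj// sub0r normrN ger0_norm ?nsq_ge0// => hN.
set D := fun t => u_ n t - u t in LD hn *.
have E1 : inner (proj N D) v = inner (proj N (u_ n)) v - inner (proj N u) v.
  rewrite !inner_proj// -sumrB; apply: eq_bigr => J _.
  by rewrite /D innerBl ?mulrBl//; exact: L2_atom_fun.
have E2 : inner D v = inner (u_ n) v - inner u v by rewrite innerBl.
have E (a b p q x y : C) : x = a - p -> y = b - q -> p - q = (a - b) + (- x + y).
  by move=> -> ->; ring.
rewrite (E _ _ _ _ _ _ E1 E2).
apply: le_lt_trans (nsqD_le _ _) _.
have h1 := nsqD_le (- inner (proj N D) v) (inner D v).
rewrite nsqN in h1.
have h2 := proj_bound N LD Lv.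
have h3 := cauchy_schwarz LD Lv.
rewrite -/V in h2 h3; lra.
Qed.

(** [E] is a union of cells of level [k]; the condition at [code0 k] keeps out the points that lie
    in none of the generating sets. *)
Definition exact_at k E := exists2 q : {ffun 'I_k -> bool} -> bool,
  ~~ q (code0 k) & E = [set x | q (code k x)].

Lemma exact_atI k A B : exact_at k A -> exact_at k B -> exact_at k (A `&` B).
Proof.
move=> [q q0 ->] [q' q0' ->]; exists (fun J => q J && q' J).
  by rewrite negb_and q0.
by apply/seteqP; split => x /=; [move=> [-> ->]|move=> /andP].
Qed.

Lemma exact_at_gen k n : (n < k)%N -> exact_at k (F n).
Proof.
move=> nk; exists (fun J => J (Ordinal nk)); first by rewrite ffunE.
by apply/seteqP; split => x /=; [rewrite ffunE => /mem_set|rewrite ffunE => /set_mem].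
Qed.

(** Up to null cells, [cindic E] is a combination of atoms, and the projection on their span fixes
    it. *)
Lemma exact_at_expand k E v : exact_at k E -> L2 v ->
  \sum_(J : {ffun 'I_k -> bool}) inner (cindic E) (atom_fun J) * inner (atom_fun J) v =
  inner (cindic E) v.
Proof.
move=> [q q0 EE] Lv.
have cE : cindic E = fun t => \sum_(J : {ffun 'I_k -> bool}) ((q J)%:R : R)%:C * cindic (cell J) t.
  apply/funext => t; rewrite (bigD1 (code k t))//= big1 ?addr0; last first.
    move=> J Jt; rewrite /cindic indicE memNset ?mulr0//= => -[_ /eqP].
    by rewrite eq_sym (negbTE Jt).
  rewrite /cindic !indicE; have [qt|qt] := boolP (q (code k t)).
    rewrite !mem_set ?mulr1//=; last by rewrite EE.
    by split => //; apply: contraTneq qt => ->.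
  by rewrite memNset ?mul0r// EE /= (negbTE qt).
have LE : L2 (cindic E) by rewrite cE; apply: L2_sum => J; exact: L2Z.
have cEv g : L2 g -> inner (cindic E) g =
    \sum_(J : {ffun 'I_k -> bool}) ((q J)%:R : R)%:C * inner (cindic (cell J)) g.
  move=> Lg; rewrite cE inner_suml//; last by move=> J; exact: L2Z.
  by apply: eq_bigr => J _; rewrite innerZl.
rewrite [RHS]cEv//; apply: eq_bigr => J _.
rewrite inner_atomr// inner_atoml// cEv// (bigD1 J)//= big1 ?addr0; last first.
  move=> J' J'J; rewrite inner_cindic; [|exact: measurable_cell..].
  rewrite (_ : _ `&` _ = set0) ?measure0 ?mulr0//.
  apply/seteqP; split => x //= [[_ h1] [_ h2]].
  by move: J'J; rewrite -h1 -h2 eqxx.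
rewrite inner_cindic; [|exact: measurable_cell..]; rewrite setIid -/(m J).
have [m0|m0] := eqVneq (m J) 0.
  (* The atom of a null cell is zero, and the cell contributes nothing to the other side either, by
     the Cauchy-Schwarz inequality. *)
  have -> : inner (cindic (cell J)) v = 0; last by rewrite !mulr0.
  apply: nsq_eq0; apply/eqP; rewrite eq_le nsq_ge0 andbT.
  apply: le_trans (cauchy_schwarz (Lcell J) Lv) _.
  by rewrite sqnorm_cindic ?[fine _]m0 ?mul0r//; exact: measurable_cell.
have E1 (a b c x : C) : a * a * c = 1 -> a * (b * c) * (a * x) = b * x.
  by move=> h; rewrite -[RHS]mul1r -h; ring.
by apply: E1; rewrite !realM -invfM -expr2 sqr_sqrtr// mulVf.
Qed.

Lemma expandable_exact k0 E : measurable E -> (mu E < +oo)%E ->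
  (forall k, (k0 <= k)%N -> exact_at k E) -> expandable (cindic E).
Proof.
move=> mE Eoo ex; split=> [|v Lv]; first exact: L2_cindic.
by split; apply: cvg_near_cst; exists k0 => // k /= /ex xk; rewrite exact_at_expand.
Qed.

Lemma expandable_resolution : (forall u, L2 u -> expandable u) ->
  resolution (fun N (J : {ffun 'I_N -> bool}) => atom_fun J).
Proof.
move=> h; split.
- by move=> N J; exact: L2_atom_fun.
- by move=> N u /(proj_bessel N)[].
- by move=> u v Lu Lv; have [_] := h u Lu; apply.
Qed.

End atoms.

(** * Density of the span of the atoms *)

Section density.
Variables (R : realType) (d : nat).
Local Notation C := R[i].
Local Notation Re := (@complex.Re R).
Local Notation Im := (@complex.Im R).
Local Notation Rd := 'rV[R]_d.
Local Notation mu := (lebesgue_rV R d).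
Implicit Types (f g u v : Rd -> C) (A B E : set Rd).

Definition cube (M : nat) : set Rd :=
  [set x | forall i, `[- M%:R, M%:R]%classic (x ord0 i)].

Lemma measurable_coord_preimage (i : 'I_d) (Y : set R) : measurable Y ->
  measurable [set x : Rd | Y (x ord0 i)].
Proof.
by move=> mY; have := @measurable_coord R d i measurableT Y mY; rewrite setTI.
Qed.

Lemma measurable_cube M : measurable (cube M).
Proof.
rewrite (_ : cube M = \bigcap_(i : 'I_d)
  [set x : Rd | `[- M%:R, M%:R]%classic (x ord0 i)]).
  by apply: fin_bigcap_measurable => // i _; exact: measurable_coord_preimage.
by apply/seteqP; split => x /= h i; [move=> _|]; exact: h.
Qed.

Lemma cube_lty M : (mu (cube M) < +oo)%E.
Proof.
rewrite /cube (@lebesgue_rV_box R d (fun=> `[- M%:R, M%:R]%classic))//.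
suff : (0 <= \prod_(i < d) lebesgue_measure (`[(- M%:R)%R, M%:R%R]%classic : set R) < +oo)%E.
  by case/andP.
elim/big_ind : _ => [|x y /andP[x0 xoo] /andP[y0 yoo]|i _].
- by rewrite lee01 ltry.
- by rewrite mule_ge0// lte_mul_pinfty// ge0_fin_numE.
- by rewrite measure_ge0 lebesgue_measure_itv/=; case: ifP; rewrite ?ltry// -EFinB ltry.
Qed.

Lemma cubeI_lty A M : measurable A -> (mu (A `&` cube M) < +oo)%E.
Proof.
move=> mA; apply: le_lt_trans (cube_lty M); apply: le_measure; rewrite ?inE.
- by apply: measurableI => //; exact: measurable_cube.
- exact: measurable_cube.
- exact: subIsetr.
Qed.

(** The cube makes the measure finite, and rational endpoints keep the family countable. [None]
    gives the cube itself, inside which complements will be taken. *)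
Definition cube_ray (k : nat * option ('I_d * rat)) : set Rd :=
  cube k.1 `&` (if k.2 is Some (i, q) then [set x | ratr q < x ord0 i] else setT).

(* A countable family of sets of finite measure that generates the Borel sets. *)
Definition cube_rays (n : nat) : set Rd :=
  if unpickle n is Some k then cube_ray k else set0.

Lemma cube_raysE k : cube_rays (pickle k) = cube_ray k.
Proof. by rewrite /cube_rays pickleK. Qed.

Lemma measurable_ray (i : 'I_d) (b : R) : measurable [set x : Rd | b < x ord0 i].
Proof.
rewrite (_ : [set x | _] = [set x : Rd | `]b, +oo[%classic (x ord0 i)]).
  exact: measurable_coord_preimage.
by apply/seteqP; split => x /=; rewrite in_itv/= andbT.
Qed.

Lemma measurable_cube_rays n : measurable (cube_rays n).
Proof.
rewrite /cube_rays; case: unpickle => [[M o]|//].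
apply: measurableI; first exact: measurable_cube.
by case: o => [[i q]|]//=; exact: measurable_ray.
Qed.

Lemma cube_rays_lty n : (mu (cube_rays n) < +oo)%E.
Proof.
have := measurable_cube_rays n; rewrite /cube_rays; case: unpickle => [[M o]|_]; last by rewrite measure0.
move=> mk; apply: le_lt_trans (cube_lty M); apply: le_measure; rewrite ?inE//.
  exact: measurable_cube.
exact: subIsetl.
Qed.

Local Notation exact_at := (exact_at cube_rays).
Local Notation expandable := (expandable cube_rays).

(** The pi-system of the Dynkin argument. The level [k0] depends on the cube, because each ray
    enters the list once per cube, at an index that depends on the cube. *)
Definition exact_sets : set (set Rd) := [set A | measurable A /\
  forall M, exists k0, forall k, (k0 <= k)%N -> exact_at k (A `&` cube M)].

Lemma exact_setsI : setI_closed exact_sets.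
Proof.
move=> A B [mA hA] [mB hB]; split; first exact: measurableI.
move=> M; have [a ha] := hA M; have [b hb] := hB M.
exists (maxn a b) => k; rewrite geq_max => /andP[ak bk].
have := exact_atI (ha k ak) (hb k bk).
by rewrite setIACA setIid.
Qed.

Lemma exact_sets_ray (i : 'I_d) (q : rat) : exact_sets [set x | ratr q < x ord0 i].
Proof.
split; first exact: measurable_ray.
move=> M; exists (pickle (M, Some (i, q))).+1 => k hk.
by rewrite setIC -[X in exact_at k X](cube_raysE (M, Some (i, q))); exact: exact_at_gen.
Qed.

Lemma exact_sets_generate : (@measurable _ Rd) = <<s exact_sets >>.
Proof.
apply/seteqP; split; last first.
  by apply: smallest_sub; [exact: sigma_algebra_measurable|move=> A []].
move=> A mA; apply: (@sigma_algebra_preimage_rV R Rd <<s exact_sets >> d id _ _ A mA).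
  exact: smallest_sigma_algebra.
move=> i b /=.
(* An open ray with a real endpoint is the union of the rays with larger rational endpoints. *)
rewrite (_ : [set t | _] = \bigcup_n (if unpickle n is Some q then
    (if b < ratr (q : rat) then [set x : Rd | ratr q < x ord0 i] else set0) else set0)).
  apply: sigma_algebra_bigcup => n; case: unpickle => [q|]; last exact: sigma_algebra0.
  case: ifP => _; last exact: sigma_algebra0.
  apply: sub_sigma_algebra; exact: exact_sets_ray.
apply/seteqP; split => x /=.
  move=> bx; have [q] := rat_in_itvoo bx; rewrite in_itv/= => /andP[bq qx].
  exists (pickle q); first exact: I.
  by rewrite pickleK bq; exact: qx.
move=> [n _]; case: unpickle => [q|//]; case: ifP => // bq /=.
exact: lt_trans.
Qed.

Lemma cindicD A B : A `&` B = set0 ->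
  cindic (A `|` B) = (fun t => cindic A t + cindic B t) :> (Rd -> C).
Proof.
move=> AB; apply/funext => t; rewrite /cindic !indicE in_setU.
have [tA|tA] := boolP (t \in A); have [tB|tB] := boolP (t \in B);
  apply: complex_ext; rewrite /= ?addr0 ?add0r//.
exfalso; have : (A `&` B) t := conj (set_mem tA) (set_mem tB).
by rewrite AB.
Qed.

(** Dynkin's argument for fixed [M]. Complements are taken inside the cube, which is itself
    expandable, and a countable disjoint union is a limit of finite ones, dominated by the indicator
    function of the cube. *)
Lemma expandable_cindic M A : measurable A -> expandable (cindic (A `&` cube M)).
Proof.
have mE := measurable_cube_rays; have mc := measurable_cube M.
have hcube : expandable (cindic (setT `&` cube M)).
  apply: (expandable_exact mE cube_rays_lty (k0 := (pickle (M, None : option ('I_d * rat))).+1)).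
  - exact: measurableI.
  - exact: cubeI_lty.
  - move=> k hk; rewrite setIC -[X in exact_at k X](cube_raysE (M, None)).
    exact: exact_at_gen.
have hC (X : set Rd) : measurable X -> expandable (cindic (X `&` cube M)) ->
    expandable (cindic (~` X `&` cube M)).
  move=> mX hX.
  rewrite (_ : cindic (~` X `&` cube M) = fun t => cindic (setT `&` cube M) t +
      (-1) * cindic (X `&` cube M) t); 
    have H := expandableD mE cube_rays_lty hcube (expandableZ mE cube_rays_lty (-1) hX).
    exact: H.
  have -> : setT `&` cube M = (X `&` cube M) `|` (~` X `&` cube M).
    by rewrite -setIUl setUv.
  rewrite cindicD; last by rewrite setIACA setICr set0I.
  by apply/funext => t; rewrite mulN1r addrAC subrr add0r.
move=> mA; move: (mA); rewrite exact_sets_generate.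
move: A {mA}; apply: (dynkin_induction exact_sets_generate exact_setsI) => //.
- move=> A [mA] /(_ M)[k0 hk0].
  apply: (expandable_exact mE cube_rays_lty _ _ hk0); last exact: cubeI_lty.
  exact: measurableI.
- move=> G mG tG hG.
  pose U n := \bigcup_(k < n) G k.
  have mU n : measurable (U n) by apply: bigcup_measurable => k _; exact: mG.
  have mUU : measurable (\bigcup_k G k) by exact: bigcup_measurable.
  apply: (expandable_lim mE cube_rays_lty (u_ := fun n => cindic (U n `&` cube M))).
  + elim=> [|n IH].
      rewrite /U bigcup_mkord big_ord0 set0I.
      rewrite (_ : cindic _ = fun=> 0); first exact: (expandable0 mE cube_rays_lty).
      by apply/funext => t; rewrite /cindic indic0.
    rewrite (_ : U n.+1 = U n `|` G n); last by rewrite /U !bigcup_mkord big_ord_recr.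
    rewrite setIUl cindicD.
      have H := expandableD mE cube_rays_lty IH (hG n).
      exact: H.
    rewrite setIACA setIid (_ : U n `&` G n = set0) ?set0I//.
    rewrite /U setI_bigcupl bigcup0// => k /= kn.
    by move/trivIsetP : tG => /(_ k n I I); apply; rewrite ltn_eqF.
  + by apply: L2_cindic; [exact: measurableI|exact: cubeI_lty].
  + apply: (@sqnorm_dominated_cvg _ _ _ _ (\1_(cube M))).
    * by move=> n; apply: L2_cindic; [exact: measurableI|exact: cubeI_lty].
    * by apply: L2_cindic; [exact: measurableI|exact: cubeI_lty].
    * apply/integrableP; split; first by apply/measurable_EFinP; exact: measurable_indic.
      rewrite (_ : (fun x => _) = fun x => (\1_(cube M) x)%:E); last first.
        by apply/funext => t /=; rewrite indicE; case: (_ \in _); rewrite ?normr1 ?normr0.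
      by rewrite integral_indic ?setIT//; exact: cube_lty.
    * move=> t; have [[n _ Gn]|h] := pselect ((\bigcup_k G k) t).
        have E k : (n < k)%N -> cindic (U k `&` cube M) t = cindic (\bigcup_k G k `&` cube M) t.
          move=> nk; rewrite /cindic !indicE; congr ((_%:R)%:C); rewrite !in_setI.
          have -> : t \in U k by apply/mem_set; exists n.
          by have -> : t \in \bigcup_k G k by apply/mem_set; exists n.
        split; apply: cvg_near_cst; exists n.+1 => // k nk.
        exact: (congr1 Re (E k nk)).
      have E k : cindic (U k `&` cube M) t = cindic (\bigcup_k G k `&` cube M) t.
        rewrite /cindic !indicE; congr ((_%:R)%:C); rewrite !in_setI.
        have -> : (t \in U k) = false by apply/memNset => -[j _ Gj]; apply: h; exists j.
        by have -> : (t \in \bigcup_k G k) = false by exact/memNset.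
      split; apply: cvg_near_cst; apply: nearW => k.
        exact: (congr1 Re (E k)).
      exact: (congr1 Im (E k)).
    * move=> n t; rewrite /cindic !indicE !in_setI; case: (t \in cube M).
        by case: (_ \in _); case: (_ \in _);
          rewrite /nsq/= ?subrr ?sub0r ?subr0 ?oppr0 ?sqrrN ?expr1n ?expr0n ?addr0// ler01.
      by rewrite !andbF subrr /nsq/= expr0n addr0.
Qed.

Lemma cube_near (t : Rd) : \forall M \near \oo, cube M t.
Proof.
pose s := \sum_i `|t ord0 i|.
exists (Num.bound s) => // M /= sM i; rewrite /= in_itv/= -ler_norml.
apply: (@le_trans _ _ s); first by rewrite /s (bigD1 i)//= lerDl sumr_ge0.
apply: (le_trans (ltW (archi_boundP _))); first exact: sumr_ge0.
by rewrite ler_nat.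
Qed.

(** Simple functions increasing to [u], cut by growing cubes, are finite combinations of expandable
    indicator functions. They lie between 0 and [u], so the squared error is dominated by
    [u ^ 2]. *)
Lemma expandable_ge0 (u : Rd -> R) : measurable_fun setT u -> (forall t, 0 <= u t) ->
  mu.-integrable setT (EFin \o (fun t => u t ^+ 2)) ->
  expandable (fun t => (u t)%:C).
Proof.
move=> m0 u0 iu; have mE := measurable_cube_rays.
have m1 : measurable_fun setT (EFin \o u) by exact/measurable_EFinP.
pose a := nnsfun_approx measurableT m1.
have a_u n t : a n t <= u t.
  have := cvg_nnsfun_approx measurableT m1 (fun t _ => u0 t) (x := t) I => h.
  have /fine_cvg/= {}h := h.
  rewrite -(cvg_lim (@Rhausdorff R) h).
  apply: (@nondecreasing_cvgn_le _ (fun n => a n t)); last by apply/cvg_ex; exists (u t).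
  by move=> k l kl; exact/lefP/nd_nnsfun_approx.
apply: (expandable_lim mE cube_rays_lty (u_ := fun n t => (a n t)%:C * cindic (cube n) t)).
- move=> n.
  rewrite (_ : (fun t => _) = fun t => \sum_(y <- finmap.enum_fset (fset_set (range (a n))))
     y%:C * cindic (a n @^-1` [set y] `&` cube n) t).
    apply: (expandable_sum mE cube_rays_lty) => y.
    apply: (expandableZ mE cube_rays_lty); apply: expandable_cindic.
    by rewrite -[X in measurable X]setTI; exact: measurable_funP.
  apply/funext => t; rewrite {1}fimfunE fsbig_finite//=.
  rewrite (big_morph (fun r : R => r%:C) (id1 := 0) (op1 := +%R))//; last first.
    by move=> x y; apply: complex_ext; rewrite /= ?addr0.
  rewrite mulr_suml; apply: eq_bigr => y _.
  rewrite /cindic indicI /=; apply: complex_ext => /=; ring.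
- exact: L2_real.
- apply: (@sqnorm_dominated_cvg _ _ _ _ (fun t => u t ^+ 2)) => //.
  + move=> n; apply: (@L2_dominated _ _ _ (fun t => u t ^+ 2)) => //.
    * rewrite (_ : _ \o _ = fun t => a n t * \1_(cube n) t).
        by apply: measurable_funM => //; apply: measurable_indic; exact: measurable_cube.
      by apply/funext => t; rewrite /= mulr0 subr0.
    * rewrite (_ : _ \o _ = fun=> 0); first exact: measurable_cst.
      by apply/funext => t; rewrite /= mulr0 mul0r addr0.
    * move=> t; rewrite nsqM !nsqr indicE; have := a_u n t.
      have : 0 <= a n t by [].
      by case: (_ \in _) => h1 h2; rewrite ?expr1n ?expr0n ?mulr0 ?mulr1 ?sqr_ge0// ler_sqr ?nnegrE.
  + exact: L2_real.
  + move=> t; have h : (fun n => a n t) @ \oo --> u t.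
      have := cvg_nnsfun_approx measurableT m1 (fun t _ => u0 t) (x := t) I.
      by move=> /fine_cvg.
    have E : \forall n \near \oo, (a n t)%:C * cindic (cube n) t = (a n t)%:C.
      have := cube_near t; apply: filterS => n ct.
      by rewrite /cindic indicE mem_set// mulr1.
    split; last first.
      by apply: cvg_near_cst; move: E; apply: filterS => n En; exact: (congr1 Im En).
    apply: cvg_trans h; apply: near_eq_cvg.
    by move: E; apply: filterS => n En; exact: (esym (congr1 Re En)).
  + move=> n t; have := a_u n t; have : 0 <= a n t by [].
    rewrite (_ : _ - _ = (a n t * \1_(cube n) t - u t)%:C); last first.
      by apply: complex_ext => /=; ring.
    rewrite nsqr indicE; case: (_ \in _) => h1 h2; last by rewrite mulr0 sub0r sqrrN.
    by rewrite mulr1 -sqrrN opprB ler_sqr ?nnegrE//; lra.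
Qed.

Lemma expandableL2 f : L2 f -> expandable f.
Proof.
move=> Lf; have mE := measurable_cube_rays.
have real (u : Rd -> R) : measurable_fun setT u ->
    mu.-integrable setT (EFin \o (fun t => u t ^+ 2)) -> expandable (fun t => (u t)%:C).
  move=> m0 iu.
  have H (v : Rd -> R) : measurable_fun setT v -> (forall t, 0 <= v t) ->
      (forall t, v t ^+ 2 <= u t ^+ 2) -> expandable (fun t => (v t)%:C).
    move=> mv v0 vu; apply: expandable_ge0 => //.
    apply: le_integrable iu => //; first by apply/measurable_EFinP; exact: measurable_funX.
    by move=> t _ /=; rewrite lee_fin !ger0_norm ?sqr_ge0.
  have hp : expandable (fun t => (Num.max (u t) 0)%:C).
    apply: H => [|t|t]; first exact: measurable_maxr.
      by rewrite le_max lexx orbT.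
    by case: (leP (u t) 0) => h; rewrite ?expr0n ?sqr_ge0.
  have hn : expandable (fun t => (Num.max (- u t) 0)%:C).
    apply: H => [|t|t].
    - by apply: measurable_maxr => //; exact: measurableT_comp.
    - by rewrite le_max lexx orbT.
    by case: (leP (- u t) 0) => h; rewrite ?expr0n ?sqr_ge0 ?sqrrN.
  have := expandableD mE cube_rays_lty hp (expandableZ mE cube_rays_lty (-1) hn).
  congr expandable; apply/funext => t; apply: complex_ext => /=.
    by case: (leP (u t) 0) => h1; case: (leP (- u t) 0) => h2; lra.
  by rewrite ?mulr0 ?mul0r ?addr0 ?oppr0 ?mul0r ?addr0.
have iRe : mu.-integrable setT (EFin \o (fun t => Re (f t) ^+ 2)).
  apply: le_integrable (L2_nsq Lf) => //.
    by apply/measurable_EFinP; apply: measurable_funX; exact: L2_mRe.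
  by move=> t _ /=; rewrite lee_fin !ger0_norm ?sqr_ge0 ?nsq_ge0 ?Re_sqr_le.
have iIm : mu.-integrable setT (EFin \o (fun t => Im (f t) ^+ 2)).
  apply: le_integrable (L2_nsq Lf) => //.
    by apply/measurable_EFinP; apply: measurable_funX; exact: L2_mIm.
  by move=> t _ /=; rewrite lee_fin !ger0_norm ?sqr_ge0 ?nsq_ge0 ?Im_sqr_le.
have h1 := real _ (L2_mRe Lf) iRe; have h2 := real _ (L2_mIm Lf) iIm.
have := expandableD mE cube_rays_lty h1 (expandableZ mE cube_rays_lty (0 +i* 1) h2).
congr expandable; apply/funext => t; apply: complex_ext; rewrite !ReImE/=; ring.
Qed.

Lemma cube_ray_resolution : resolution (fun N (J : {ffun 'I_N -> bool}) =>
  @atom_fun R d cube_rays N J).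
Proof.
apply: expandable_resolution; [exact: measurable_cube_rays|exact: cube_rays_lty|].
exact: expandableL2.
Qed.

End density.

Theorem theorem6p3 (R : realType) (d : nat) (d_gt0 : (0 < d)%N) :
  (forall S : ('rV[R]_d -> R[i]) -> 'rV[R]_d -> R[i],
    trace_class S ->
    dense (~` [set z | Fourier_Wigner S z = 0]) ->
    forall Omega Omega' : set ('rV[R]_d * 'rV[R]_d),
    finite_Lebesgue_measure Omega -> finite_Lebesgue_measure Omega' ->
    forall T : ('rV[R]_d -> R[i]) -> 'rV[R]_d -> R[i],
    is_convolution (chi Omega) S T -> is_convolution (chi Omega') S T ->
    (lebesgue_rV R d \x lebesgue_rV R d)%E.-negligible (Omega `+` Omega'))
  /\
  (forall phi1 phi2 : 'rV[R]_d -> R[i],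
    L2 phi1 -> L2 phi2 ->
    dense (~` [set z | cross_ambiguity phi2 phi1 z = 0]) ->
    forall Omega Omega' : set ('rV[R]_d * 'rV[R]_d),
    finite_Lebesgue_measure Omega -> finite_Lebesgue_measure Omega' ->
    forall T : ('rV[R]_d -> R[i]) -> 'rV[R]_d -> R[i],
    is_localization Omega phi1 phi2 T -> is_localization Omega' phi1 phi2 T ->
    (lebesgue_rV R d \x lebesgue_rV R d)%E.-negligible (Omega `+` Omega')).
Proof.
have re := cube_ray_resolution R d; split.
  move=> S /trace_class_nuclear[s [xi [eta nS]]] dS Omega Omega' fO fO' T [_ hT] [_ hT'].
  apply: (nuclear_determines nS re dS _ fO fO') => [zeta /eqP|f g Lf Lg].
    exact: Fourier_Wigner_neq0.
  by rewrite -hT// -hT'.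
move=> phi1 phi2 L1 L2' dA Omega Omega' fO fO' T [_ hT] [_ hT'].
apply: (nuclear_determines (rank_one_nuclear L1 L2') re dA _ fO fO') => [zeta /eqP h|f g Lf Lg].
  (* For a rank one operator the series has only its term of index 0, so its partial sums are
     constant from length 1 on. *)
  exists (inner (tfshift (- zeta) phi2) phi1); first exact: cross_ambiguity_neq0.
  split; apply: cvg_near_cst; exists 1%N => // -[//|K] _ /=.
    rewrite big_ord_recl/= mul1r big1 ?addr0// => i _; exact: mul0r.
  rewrite big_ord_recl/= mul1r big1 ?addr0// => i _; exact: mul0r.
by rewrite -!Cintegral_localization// -hT// -hT'.
Qed.
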